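(* Let $p<q$ be odd primes. Then the oriented multi-virtual knot $K(p)$ is not equivalent to $K(q)$.
   Context: Fix a set $T$ of types containing two distinct types $\alpha\neq\beta$. A multi-virtual link diagram (of type $T$) is a planar link diagram in which each crossing is either classical (with over/under information) or virtual, and each virtual crossing is assigned a type from $T$. Two oriented diagrams are equivalent if one is obtained from the other by finitely many applications of planar isotopy, classical Reidemeister moves and multi-virtual detour moves, respecting orientations. A multi-virtual detour move excises a strand along which one meets a (possibly empty) consecutive sequence of crossings that are all virtual and all of the same type, and reconnects the endpoints by another arc meeting the rest of the diagram (and possibly itself) transversally, with all resulting crossings declared virtual of that same type; loops of that virtual type may be freely added to or removed from the strand. For $n\ge 1$, $K(n)$ is the oriented multi-virtual knot given by the closure of the 2-strand braid-like diagram (both strands oriented in the same direction) consisting, in the direction of the orientation, of $2n$ virtual crossings of alternating types $\alpha,\beta,\alpha,\beta,\dots,\alpha,\beta$, followed by a single positive classical crossing (with both strands directed upward, the strand going from bottom-left to top-right is the over-strand); the two strands are then closed up by arcs without further crossings. *)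

(* Defs.v *)
From Stdlib Require Import Relations.
From HB Require Import structures.
From mathcomp Require Import all_boot all_order all_algebra.
From mathcomp Require Import all_classical reals topology normedtype.
From mathcomp Require Import ring lra zify.
Set Implicit Arguments.
Unset Strict Implicit.
Unset Printing Implicit Defensive.
Import Order.TTheory GRing.Theory Num.Theory numFieldNormedType.Exports.
Local Open Scope classical_set_scope.
Local Open Scope ring_scope.

(* Link diagrams are taken in the piecewise-linear category: the underlying   *)
(* immersed oriented closed curves are polygons in the plane R x R, given by  *)
(* their directed edges (source vertex, target vertex).                       *)

Section Plane.
Variable R : realType.

Definition pt : Type := (R * R)%type.
Definition edge : Type := (pt * pt)%type.

Definition pt_on (e : edge) (t : R) : pt :=
  ((1 - t) * e.1.1 + t * e.2.1, (1 - t) * e.1.2 + t * e.2.2).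

Definition on_seg (x : pt) (e : edge) : Prop :=
  exists2 t : R, 0 <= t <= 1 & x = pt_on e t.

Definition on_open_seg (x : pt) (e : edge) : Prop :=
  exists2 t : R, 0 < t < 1 & x = pt_on e t.

Definition in_triangle (x A B C : pt) : Prop :=
  exists a b c : R,
    [/\ 0 <= a, 0 <= b, 0 <= c, a + b + c = 1 &
        x = (a * A.1 + b * B.1 + c * C.1, a * A.2 + b * B.2 + c * C.2)].

Definition crosses (e f : edge) : Prop :=
  e <> f /\ exists x : pt, on_open_seg x e /\ on_open_seg x f.

(* Every vertex has exactly one outgoing and one incoming edge, so that E     *)
(* decomposes into oriented closed polygons.                                  *)
Definition closed_polygons (E : seq edge) : Prop :=
  uniq (unzip1 E) /\ perm_eq (unzip1 E) (unzip2 E).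

(* General position.  By the third clause no vertex lies on an edge other     *)
(* than its two incident ones; this also excludes overlapping edges, so any   *)
(* two edges that meet away from a common vertex cross transversally.         *)
Definition generic (E : seq edge) : Prop :=
  [/\ forall e, e \in E -> e.1 <> e.2,
      forall e, e \in E -> (e.2, e.1) \notin E,
      forall e f, e \in E -> f \in E -> on_seg f.1 e -> f.1 = e.1 \/ f.1 = e.2 &
      forall e f g x, e \in E -> f \in E -> g \in E ->
        on_seg x e -> on_seg x f -> on_seg x g ->
        [\/ e = f, f = g | e = g]].

Definition chain (A : pt) (s : seq pt) (B : pt) : seq edge :=
  zip (A :: s) (rcons s B).

End Plane.

(* [Over] as the decoration of (e, f) means that e passes over f.             *)
Inductive decoration (T : Type) : Type := Over | Under | Virtual of T.
Arguments Over {T}.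
Arguments Under {T}.

Definition flip (T : Type) (d : decoration T) : decoration T :=
  match d with Over => Under | Under => Over | Virtual c => Virtual c end.

Definition classical_deco (T : Type) (d : decoration T) : Prop :=
  d = Over \/ d = Under.

(* Two edges cross at most once, so crossings are indexed by pairs of edges;  *)
(* [deco] is irrelevant on pairs that do not cross.                           *)
Record diagram (R : realType) (T : Type) := Diagram {
  edges : seq (edge R);
  deco : edge R -> edge R -> decoration T;
  edges_closed : closed_polygons edges;
  edges_generic : generic edges;
  deco_flip : forall e f, e \in edges -> f \in edges -> crosses e f ->
    deco f e = flip (deco e f) }.

Section Moves.
Variables (R : realType) (T : Type).
Implicit Types (D : diagram R T) (A B C : pt R) (s : seq (pt R)).
Implicit Types (F : seq (edge R)).

Definition move_edge (h : pt R -> pt R) (e : edge R) : edge R := (h e.1, h e.2).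

(* Continuous motion of the vertices through diagrams in general position     *)
(* with the same crossings; combined with [subdivision], this is planar       *)
(* isotopy.                                                                   *)
Definition vertex_isotopy D D' : Prop :=
  exists h : R -> pt R -> pt R,
    [/\ forall v, v \in unzip1 (edges D) ->
          h 0 v = v /\ {within `[0, 1], continuous (fun t => h t v)},
        forall t, 0 <= t <= 1 ->
          let E := map (move_edge (h t)) (edges D) in
          [/\ closed_polygons E, generic E &
              forall e f, e \in edges D -> f \in edges D ->
                crosses (move_edge (h t) e) (move_edge (h t) f) <->
                crosses e f],
        perm_eq (edges D') (map (move_edge (h 1)) (edges D)) &
        forall e f, e \in edges D -> f \in edges D -> crosses e f ->
          deco D' (move_edge (h 1) e) (move_edge (h 1) f) = deco D e f].

(* D' is D with the strand A -> s -> B replaced by A -> s' -> B; F is the     *)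
(* common rest.  A = B is allowed.                                            *)
Definition redraw A s s' B F D D' : Prop :=
  [/\ perm_eq (edges D) (chain A s B ++ F),
      perm_eq (edges D') (chain A s' B ++ F) &
      forall e f, e \in F -> f \in F -> crosses e f ->
        deco D' e f = deco D e f].

Definition subdivision D D' : Prop :=
  exists A B C F,
    [/\ redraw A [::] [:: C] B F D D',
        on_open_seg C (A, B),
        forall f, f \in F -> crosses (A, C) f ->
          deco D' (A, C) f = deco D (A, B) f &
        forall f, f \in F -> crosses (C, B) f ->
          deco D' (C, B) f = deco D (A, B) f].

(* The Reidemeister moves replace an edge AB by AC, CB, where the triangle    *)
(* ABC meets the rest of the diagram, apart from the points A and B, only in  *)
(* the edges explicitly mentioned.                                            *)
Definition avoids_triangle A B C (g : edge R) : Prop :=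
  forall x, on_seg x g -> in_triangle x A B C -> x = A \/ x = B.

(* The edge leaving B exits the triangle through AC: a kink is created.       *)
Definition reidemeister1 D D' : Prop :=
  exists A B C E F,
    [/\ redraw A [::] [:: C] B F D D',
        (B, E) \in F /\ crosses (A, C) (B, E),
        forall g, g \in F -> g <> (B, E) -> avoids_triangle A B C g &
        classical_deco (deco D' (A, C) (B, E))].

(* The edge f cuts off the corner C.                                          *)
Definition reidemeister2 D D' : Prop :=
  exists A B C f F,
    [/\ redraw A [::] [:: C] B F D D',
        [/\ f \in F, crosses (A, C) f & crosses (C, B) f],
        forall g, g \in F -> g <> f -> avoids_triangle A B C g,
        classical_deco (deco D' (A, C) f) &
        deco D' (C, B) f = deco D' (A, C) f].

(* The edges f and g cross inside the triangle, f cutting off the corner A    *)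
(* and g the corner B.  The last clause says that none of the three strands   *)
(* AB, f, g lies cyclically over the next, i.e. that one is on top and one at *)
(* the bottom.                                                                *)
Definition reidemeister3 D D' : Prop :=
  exists A B C f g F,
    [/\ redraw A [::] [:: C] B F D D',
        [/\ f \in F, crosses (A, B) f, crosses (A, C) f &
            deco D' (A, C) f = deco D (A, B) f],
        [/\ g \in F, crosses (A, B) g, crosses (C, B) g &
            deco D' (C, B) g = deco D (A, B) g],
        (f <> g /\ exists x, [/\ on_open_seg x f, on_open_seg x g & in_triangle x A B C]) /\
        (forall k, k \in F -> k <> f -> k <> g -> avoids_triangle A B C k) &
        [/\ classical_deco (deco D (A, B) f), classical_deco (deco D f g),
            classical_deco (deco D g (A, B)) &
            ~ (deco D (A, B) f = deco D f g /\ deco D f g = deco D g (A, B))]].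

(* Includes the self-crossings of the strand.                                 *)
Definition strand_virtual (c : T) A s B D : Prop :=
  forall e f, e \in chain A s B -> f \in edges D -> crosses e f ->
    deco D e f = Virtual c.

Definition detour D D' : Prop :=
  exists c A s s' B F,
    [/\ redraw A s s' B F D D',
        strand_virtual c A s B D & strand_virtual c A s' B D'].

Definition elementary_move D D' : Prop :=
  vertex_isotopy D D' \/ subdivision D D' \/
  reidemeister1 D D' \/ reidemeister2 D D' \/ reidemeister3 D D' \/
  detour D D'.

Definition equivalent : relation (diagram R T) :=
  clos_refl_sym_trans (diagram R T) elementary_move.

End Moves.

Section KnotK.
Variable R : realType.
Implicit Types (n i : nat).

(* The two strands of the upward braid-like part stand at x = 0 and x = 1 and *)
(* cross once in each horizontal band i <= y <= i + 1, for i <= 2n.           *)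
Local Notation bot i := ((0, i%:R), (1, i.+1%:R) : pt R).
Local Notation top i := ((1, i%:R), (0, i.+1%:R) : pt R).

Definition rising n : seq (edge R) :=
  [seq bot i | i <- iota 0 n.*2.+1].
Definition falling n : seq (edge R) :=
  [seq top i | i <- iota 0 n.*2.+1].

Definition inner_arc n : seq (edge R) :=
  chain (1, n.*2.+1%:R) [:: (2, 0)] (1, 0).
Definition outer_arc n : seq (edge R) :=
  chain (0, n.*2.+1%:R) [:: (3, n.*2.+2%:R); (3, -1)] (0, 0).

Definition K_edges n : seq (edge R) :=
  rising n ++ falling n ++ inner_arc n ++ outer_arc n.

(* Bands 0, ..., 2n - 1 are virtual of types a, b, a, b, ...; in band 2n the  *)
(* edge from bottom-left to top-right is the over-strand.                     *)
Definition K_deco (T : Type) (a b : T) n (e f : edge R) : decoration T :=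
  let i := Num.truncn e.1.2 in
  if (i < n.*2)%N then Virtual (if odd i then b else a)
  else if e.1.1 == 0 then Over else Under.



Inductive K_spec n : edge R -> nat -> Prop :=
| K_rising i of (i <= n.*2)%N : K_spec n (bot i) 0
| K_falling i of (i <= n.*2)%N : K_spec n (top i) 1
| K_inner1 : K_spec n ((1, n.*2.+1%:R), (2, 0)) 2
| K_inner2 : K_spec n ((2, 0), (1, 0)) 3
| K_outer1 : K_spec n ((0, n.*2.+1%:R), (3, n.*2.+2%:R)) 4
| K_outer2 : K_spec n ((3, n.*2.+2%:R), (3, -1)) 5
| K_outer3 : K_spec n ((3, -1), (0, 0)) 6.

Lemma K_edgesP n e : e \in K_edges n -> exists k, K_spec n e k.
Proof.
rewrite /K_edges !mem_cat => /or4P[/mapP[i]|/mapP[i]||].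
- by rewrite mem_iota => /andP[_ ?] ->; exists 0%N; constructor.
- by rewrite mem_iota => /andP[_ ?] ->; exists 1%N; constructor.
- rewrite /inner_arc /chain /= !inE.
  by case/orP => /eqP ->; [exists 2%N | exists 3%N]; constructor.
- rewrite /outer_arc /chain /= !inE.
  by case/or3P => /eqP ->; [exists 4%N | exists 5%N | exists 6%N]; constructor.
Qed.

Definition K_meet (e f : edge R) (x : pt R) : Prop :=
  [\/ e = f, x = e.2 /\ x = f.1, x = e.1 /\ x = f.2 |
      exists i, (e = bot i /\ f = top i \/ e = top i /\ f = bot i) /\
                x = (1 / 2, i%:R + 1 / 2)].

Lemma K_meet_sym e f x : K_meet e f x -> K_meet f e x.
Proof.
case=> [->|[? ?]|[? ?]|[i [[[-> ->]|[-> ->]] ->]]].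
- exact: Or41.
- exact: Or43.
- exact: Or42.
- by apply: Or44; exists i; split=> //; right.
- by apply: Or44; exists i; split=> //; left.
Qed.

Lemma nat_cmp (i j : nat) :
  [\/ i = j, (i%:R + 1 <= j%:R :> R) | (j%:R + 1 <= i%:R :> R)].
Proof.
case: (ltngtP i j) => h; first by apply: Or32; rewrite natr1 ler_nat.
  by apply: Or33; rewrite natr1 ler_nat.
exact: Or31.
Qed.

Lemma K_meetP n e f k l x : K_spec n e k -> K_spec n f l -> (k <= l)%N ->
  on_seg x e -> on_seg x f -> K_meet e f x.
Proof.
move=> He Hf kl [t /andP[t0 t1] Hx] [s /andP[s0 s1] Hy].
have N0 : (0 <= n.*2%:R :> R) by rewrite ler0n.
have e1 : (n.*2.+1%:R = n.*2%:R + 1 :> R) by rewrite natr1.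
have e2 : (n.*2.+2%:R = n.*2%:R + 2 :> R) by rewrite -natr1 e1; ring.
case: He kl Hx => [i ni|i ni|||||] kl Hx; case: Hf kl Hy => [j nj|j nj|||||] // _ Hy;
  try exact: Or41; move: (Hy); rewrite {1}Hx /pt_on /=; case=> E1 E2;
  rewrite ?e1 ?e2 -?natr1 in E1 E2.
all: have pM (k' : nat) : (k' <= n.*2)%N -> (0 <= (k'%:R : R) <= n.*2%:R)
       by rewrite ler0n ler_nat.
- have := pM _ ni; have := pM _ nj => bj bi.
  case: (nat_cmp i j) => [->|h|h]; [exact: Or41 | lra | lra].
- case: (nat_cmp i j) => [ij|h|h].
  + apply: Or44; exists j; rewrite ij; split; first by left.
    by rewrite Hy /pt_on /= -natr1; rewrite ij in E2; congr pair; lra.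
  + have T : t = 1 by lra.
    have S : s = 0 by lra.
    by apply: Or42; split; [rewrite Hx T | rewrite Hy S];
       rewrite /pt_on /= -?natr1; congr pair; lra.
  + have T : t = 0 by lra.
    have S : s = 1 by lra.
    by apply: Or43; split; [rewrite Hx T | rewrite Hy S];
       rewrite /pt_on /= -?natr1; congr pair; lra.
- have T : t = 1 by lra.
  have S : s = 0 by lra.
  by apply: Or42; split; [rewrite Hx T | rewrite Hy S];
     rewrite /pt_on /= -?natr1; congr pair; lra.
- have := pM _ ni => bi.
  have T : t = 1 by lra.
  by rewrite T in E2; lra.
- have := pM _ ni => bi; lra.
- lra.
- have := pM _ ni => bi.
  have T : t = 0 by lra.
  have S : s = 1 by lra.
  by apply: Or43; split; [rewrite Hx T | rewrite Hy S];
     rewrite /pt_on /= -?natr1; congr pair; lra.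
- case: (nat_cmp i j) => [->|h|h]; [exact: Or41 | lra | lra].
- have := pM _ ni => bi.
  have T : t = 0 by lra.
  have S : s = 0 by lra.
  by rewrite T S in E2; lra.
- have := pM _ ni => bi.
  have T : t = 0 by lra.
  have S : s = 1 by lra.
  by apply: Or43; split; [rewrite Hx T | rewrite Hy S];
     rewrite /pt_on /= -?natr1; rewrite T S in E2; congr pair; lra.
- have := pM _ ni => bi.
  have T : t = 1 by lra.
  have S : s = 0 by lra.
  by apply: Or42; split; [rewrite Hx T | rewrite Hy S];
     rewrite /pt_on /= ?e1 -?natr1; rewrite T S in E2; congr pair; lra.
- lra.
- have := pM _ ni => bi; lra.
- have T : (1 - t) * (n.*2%:R + 1) = 0 by lra.
  have {}T : t = 1.
    by move/eqP: T; rewrite mulf_eq0 => /orP[/eqP|/eqP]; lra.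
  have S : s = 0 by lra.
  by apply: Or42; split; [rewrite Hx T | rewrite Hy S];
     rewrite /pt_on /= ; congr pair; lra.
- have tM : 0 <= t * n.*2%:R by exact: mulr_ge0.
  lra.
- lra.
- have tM : 0 <= (1 - t) * n.*2%:R by apply: mulr_ge0 => //; lra.
  lra.
- lra.
- lra.
- lra.
- have T : t = 1 by lra.
  have sM : 0 <= s * n.*2%:R by exact: mulr_ge0.
  have S : s = 0 by rewrite T in E2; lra.
  by apply: Or42; split; [rewrite Hx T | rewrite Hy S];
     rewrite /pt_on /= ; congr pair; lra.
- lra.
- have S : s = 0 by lra.
  have T : (1 - t) * (n.*2%:R + 3) = 0 by rewrite S in E2; lra.
  have {}T : t = 1.
    by move/eqP: T; rewrite mulf_eq0 => /orP[/eqP|/eqP]; lra.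
  by apply: Or42; split; [rewrite Hx T | rewrite Hy S];
     rewrite /pt_on /= ; congr pair; lra.
Qed.

Lemma K_edges_meet n e f x : e \in K_edges n -> f \in K_edges n ->
  on_seg x e -> on_seg x f -> K_meet e f x.
Proof.
move=> /K_edgesP[k He] /K_edgesP[l Hf] xe xf.
have [kl|/ltnW lk] := leqP k l; first exact: (K_meetP He Hf kl).
exact/K_meet_sym/(K_meetP Hf He lk).
Qed.

Lemma perm_K n :
  perm_eq (unzip1 (K_edges n)) (unzip2 (K_edges n)).
Proof.
have H (c : R) (P : pred (pt R)) :
    (count P [seq (c, (i.+1%:R)%R) | i <- iota 0 n.*2.+1] + P (c, 0%R) =
     count P [seq (c, (i%:R)%R) | i <- iota 0 n.*2.+1] + P (c, (n.*2.+1%:R)%R))%N.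
  have -> : [seq (c, i.+1%:R : R) | i <- iota 0 n.*2.+1] =
            [seq (c, i%:R) | i <- iota 1 n.*2.+1].
    by rewrite (iotaDl 1 0) -map_comp.
  have -> : iota 1 n.*2.+1 = iota 1 n.*2 ++ [:: n.*2.+1].
    by rewrite -[X in iota 1 X]addn1 iotaD add1n.
  by rewrite map_cat count_cat /= addn0 addnC addnA.
apply/permP => P.
rewrite /unzip1 /unzip2 /K_edges /rising /falling /inner_arc /outer_arc /chain.
rewrite !map_cat !count_cat -!map_comp.
move: (H 0 P) (H 1 P); move: (iota 0 n.*2.+1) => l /=; rewrite /comp /=.
move: (count P _) => a0; move: (count P _) => b0.
move: (count P _) => a1; move: (count P _) => b1.
lia.
Qed.

Lemma uniq_K n : uniq (unzip1 (K_edges n)).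
Proof.
have ui (c : R) : uniq [seq (c, i%:R : R) | i <- iota 0 n.*2.+1].
  rewrite map_inj_uniq ?iota_uniq// => i j [] /eqP.
  by rewrite eqr_nat => /eqP.
rewrite /unzip1 /K_edges /rising /falling !map_cat -!map_comp.
have nin (c : R) : (c, n.*2.+1%:R : R) \notin [seq (c, i%:R) | i <- iota 0 n.*2.+1].
  apply/mapP => -[i]; rewrite mem_iota => /andP[_ hi] [] /eqP.
  by rewrite eqr_nat => /eqP; lia.
have nin' (c d y : R) : c <> d -> (c, y) \notin [seq (d, i%:R : R) | i <- iota 0 n.*2.+1].
  by move=> cd; apply/mapP => -[i _ []].
move: (iota 0 n.*2.+1) ui nin nin' => l ui nin nin'.
rewrite cat_uniq; apply/and3P; split; first exact: ui.
  apply/hasPn => x; rewrite mem_cat => /orP[/mapP[i _ ->]|].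
    by apply: nin' => ?; lra.
  rewrite /= !inE => /orP[|/or4P[]] /eqP ->;
    by [apply: nin | apply: nin' => /= ?; lra].
rewrite cat_uniq; apply/and3P; split; first exact: ui.
  apply/hasPn => x.
  rewrite /= !inE => /orP[|/or4P[]] /eqP ->;
    by [apply: nin | apply: nin' => /= ?; lra].
have := ler0n R n.*2.+2; have := ler0n R n.*2.+1 => N1 N2.
have F (c d : R) : c <> d -> (c == d) = false by move=> /eqP/negPf.
rewrite /= !inE !xpair_eqE !(F 1) ?(F 2) ?(F 0 3) ?(F _ (-1)) ?andbF // => ?; lra.
Qed.

Lemma K_edges_closed n : closed_polygons (K_edges n).
Proof. by split; [exact: uniq_K | exact: perm_K]. Qed.

Lemma K_edge_source n e : e \in K_edges n -> e.1.1 <> 1 / 2.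
Proof. by case/K_edgesP => k; case=> * /= ?; lra. Qed.

Lemma on_seg1 (e : edge R) : on_seg e.1 e.
Proof.
by exists 0; [lra | case: e => -[a b] c; rewrite /pt_on /=; congr pair; ring].
Qed.

Lemma K_edges_generic n : generic (K_edges n).
Proof.
have inj1 e f : e \in K_edges n -> f \in K_edges n -> e.1 = f.1 -> e = f.
  move=> eK fK ef; have /(uniqP (0, 0)) U := uniq_K n.
  pose d : edge R := ((0, 0), (0, 0)).
  rewrite -(nth_index d eK) -(nth_index d fK); congr nth.
  apply: U; rewrite ?inE ?size_map ?index_mem//.
  by rewrite !(nth_map d) ?index_mem// !nth_index.
have inj2 e f : e \in K_edges n -> f \in K_edges n -> e.2 = f.2 -> e = f.
  move=> eK fK ef; have := uniq_K n; rewrite (perm_uniq (perm_K n)).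
  move=> /(uniqP (0, 0)) U; pose d : edge R := ((0, 0), (0, 0)).
  rewrite -(nth_index d eK) -(nth_index d fK); congr nth.
  apply: U; rewrite ?inE ?size_map ?index_mem//.
  by rewrite !(nth_map d) ?index_mem// !nth_index.
have ne e : e \in K_edges n -> e.1 <> e.2.
  case/K_edgesP => k; case=> /= *; case=> //; try lra.
  by have := ler0n R n.*2.+2; lra.
split=> //.
- move=> e eK; apply/negP => fK.
  have xe : on_seg (pt_on e (1 / 2)) e by exists (1 / 2); [lra|].
  have xf : on_seg (pt_on e (1 / 2)) (e.2, e.1).
    by exists (1 / 2); [lra | rewrite /pt_on /=; congr pair; lra].
  have := ne e eK; case: (K_edges_meet eK fK xe xf) => [E|[E _]|[E _]|].
  + by rewrite {2}E.
  + case: e {eK fK xe xf} E => -[a b] [c d]; rewrite /pt_on /= => -[? ?] h.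
    by apply: h; congr pair; lra.
  + case: e {eK fK xe xf} E => -[a b] [c d]; rewrite /pt_on /= => -[? ?] h.
    by apply: h; congr pair; lra.
  + by case=> i [[[-> []]|[-> []]] _]; rewrite -natr1 => *; lra.
- move=> e f eK fK fe.
  case: (K_edges_meet eK fK fe (on_seg1 f)) => [->|[-> _]|[-> _]|[i [_ E]]]; auto.
  by case: (K_edge_source fK); rewrite E.
- move=> e f g x eK fK gK xe xf xg.
  have src k l : k \in K_edges n -> l \in K_edges n -> x = k.1 \/ x = l.1 ->
      x.1 <> 1 / 2.
    by move=> kK lK [] ->; [exact: (K_edge_source kK) | exact: (K_edge_source lK)].
  have [e1|e2] := pselect (x.1 = 1 / 2).
    case: (K_edges_meet eK fK xe xf) => [->|[_ E]|[E _]|].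
    - exact: Or31.
    - by case: (src e f) => //; right.
    - by case: (src e f) => //; left.
    move=> [i [ef xi]].
    case: (K_edges_meet fK gK xf xg) => [->|[_ E]|[E _]|].
    - exact: Or32.
    - by case: (src f g) => //; right.
    - by case: (src f g) => //; left.
    move=> [j [fg xj]].
    have ij : i = j.
      by move: xi; rewrite xj => -[] /addIr /eqP; rewrite eqr_nat => /eqP.
    rewrite ij in ef; apply: Or33.
    case: ef => -[-> Ef]; case: fg => -[Ef' ->] //.
    + by exfalso; move: Ef'; rewrite Ef => -[] *; lra.
    + by exfalso; move: Ef'; rewrite Ef => -[] *; lra.
  have mt k l : k \in K_edges n -> l \in K_edges n -> on_seg x k -> on_seg x l ->
      [\/ k = l, x = k.2 /\ x = l.1 | x = k.1 /\ x = l.2].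
    move=> kK lK xk xl; case: (K_edges_meet kK lK xk xl).
    - exact: Or31.
    - exact: Or32.
    - exact: Or33.
    - by move=> [i [_ E]]; case: e2; rewrite E.
  case: (mt e f) => // [->|[A1 A2]|[A1 A2]]; first exact: Or31.
  + case: (mt e g) => // [->|[B1 B2]|[B1 B2]]; first exact: Or33.
    * by apply: Or32; apply: inj1; rewrite // -A2.
    * by case: (ne e eK); rewrite -A1.
  + case: (mt e g) => // [->|[B1 B2]|[B1 B2]]; first exact: Or33.
    * by case: (ne e eK); rewrite -A1.
    * by apply: Or32; apply: inj2; rewrite // -A2.
Qed.

Lemma K_deco_flip (T : Type) (a b : T) n e f :
  e \in K_edges n -> f \in K_edges n -> crosses e f ->
  K_deco a b n f e = flip (K_deco a b n e f).
Proof.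
have os (x : pt R) (g : edge R) : on_open_seg x g -> on_seg x g.
  by case=> t /andP[/ltW ? /ltW ?] ->; exists t => //; apply/andP.
have nend (x : pt R) (g : edge R) : g \in K_edges n -> on_open_seg x g ->
    x <> g.1 /\ x <> g.2.
  move=> gK [t /andP[t0 t1]] ->.
  have [ne _ _ _] := K_edges_generic n; have := ne g gK.
  case: g {gK ne} => -[x0 y0] [x1 y1] /= ne; rewrite /pt_on /=.
  split; case=> E1 E2; apply: ne; congr pair.
  - by apply: (mulfI (lt0r_neq0 t0)); lra.
  - by apply: (mulfI (lt0r_neq0 t0)); lra.
  - have t10 : 0 < 1 - t by lra.
    by apply: (mulfI (lt0r_neq0 t10)); lra.
  - have t10 : 0 < 1 - t by lra.
    by apply: (mulfI (lt0r_neq0 t10)); lra.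
move=> eK fK [ef [x [xe xf]]].
case: (K_edges_meet eK fK (os _ _ xe) (os _ _ xf)) => //.
- by case=> _ E; case: (nend _ _ fK xf).
- by case=> E _; case: (nend _ _ eK xe).
case=> i [[[-> ->]|[-> ->]] _]; rewrite /K_deco /= natrK eqxx oner_eq0.
- by case: ifP.
- by case: ifP.
Qed.

Definition K (T : Type) (a b : T) n : diagram R T :=
  Diagram (K_edges_closed n) (K_edges_generic n) (@K_deco_flip T a b n).

End KnotK.

(* Main.v *)
(* Label the vertices of a diagram by integers so that the label of a strand  *)
(* grows by the crossing sign (+1 or -1) at each virtual crossing of type     *)
(* alpha it goes through.  The index of a classical crossing is the           *)
(* difference of the labels of its over- and under-strand, and for k <> 0 the *)
(* signed number of crossings of index k is invariant: a kink has index 0,    *)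
(* the two crossings of a second Reidemeister move have the same index and    *)
(* opposite signs, detours of another type do not affect labels, and a detour *)
(* of type alpha shifts the labels of both strands of a crossing by the       *)
(* winding number, around the crossing, of the closed curve made of the old   *)
(* and the new strand.  The only classical crossing of K(n) has index n, for  *)
(* every labelling of K(n). *)

From mathcomp Require Import all_boot all_order all_algebra.
From mathcomp Require Import all_classical reals topology normedtype realfun.
From mathcomp Require Import ring lra zify.
Require Import Defs.
Set Implicit Arguments.
Unset Strict Implicit.
Unset Printing Implicit Defensive.
Import Order.TTheory GRing.Theory Num.Theory numFieldNormedType.Exports.
Local Open Scope classical_set_scope.
Local Open Scope ring_scope.

(** * Signed intersections of segments *)

(** The invariant is the signed number of classical crossings of a fixed index [k != 0], the index
    being read off from a labelling of the vertices that jumps by the sign of each [alpha]-crossing.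
    A labelling is not unique, and on a link of several components it may fail to exist. Invariance
    is therefore stated as [transfers D D']: every labelling of [D] gives one of [D'] with the same
    [index_count]. [elementary_move_transfers] proves this for every move, in both directions.

    The geometry is reduced to signs of [orient]. In general position two edges cross exactly when
    [isect] is nonzero ([isect_crosses], [crosses_isect]), and [cparam] orders the crossings along
    an edge. For a Reidemeister move the sides of the triangle carry no [alpha]-crossing, so they
    share one height, and the crossings involved have index 0, cancel or correspond
    ([triangle_transfers]).

    The main case is a detour of type [alpha]. The old and the new strand bound a closed curve.
    Along an edge of the rest of the diagram, the winding number of this curve about the moving
    point changes exactly as the edge crosses the two strands ([isect_ray], [chain_ray],
    [winding_shift]). Adding the winding number to the old labels thus solves the new equations off
    the strand ([exists_shift]). The labels on the new strand can then be filled in, because the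
    contributions of all [alpha]-crossings add up to zero ([labelling_extend]). At a crossing off
    the strand both heights move by the winding number about the same point, so the index is
    unchanged.

    In K(n) every labelling gives the only classical crossing the index n ([label_index]), and a
    labelling exists ([K_labelling]). Hence the count for index p is nonzero on K(p) and zero on
    K(q). *)

Section Plane.
Variable R : realType.
Implicit Types (a b c P Q : pt R) (e f g : edge R) (t s : R).

Definition orient a b c : R :=
  (b.1 - a.1) * (c.2 - a.2) - (b.2 - a.2) * (c.1 - a.1).

(** [f] crosses [e] from its right to its left side. If [e] passes over [f], this is a positive
    crossing. *)
Definition isect_pos e f : bool :=
  [&& orient e.1 e.2 f.1 < 0, 0 < orient e.1 e.2 f.2,
      orient f.1 f.2 e.2 < 0 & 0 < orient f.1 f.2 e.1].

Definition isect e f : int := (isect_pos e f)%:Z - (isect_pos f e)%:Z.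

(** Along [e] the function [orient f.1 f.2] is affine; this is its zero, that is, the parameter at
    which [e] meets the line through [f]. *)
Definition cparam e f : R :=
  orient f.1 f.2 e.1 / (orient f.1 f.2 e.1 - orient f.1 f.2 e.2).

Lemma isectC e f : isect f e = - isect e f.
Proof. by rewrite /isect opprB. Qed.

Lemma isectxx e : isect e e = 0.
Proof. by rewrite /isect subrr. Qed.

Lemma isect_posN e f : isect_pos e f -> isect_pos f e = false.
Proof.
by case/and4P => h _ _ _; apply/negP => /and4P[_ _ _]; rewrite ltNge (ltW h).
Qed.

Variant isect_spec e f : int -> Prop :=
| IsectPos of orient e.1 e.2 f.1 < 0 & 0 < orient e.1 e.2 f.2
    & orient f.1 f.2 e.2 < 0 & 0 < orient f.1 f.2 e.1 : isect_spec e f 1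
| IsectNeg of orient e.1 e.2 f.2 < 0 & 0 < orient e.1 e.2 f.1
    & orient f.1 f.2 e.1 < 0 & 0 < orient f.1 f.2 e.2 : isect_spec e f (-1)
| IsectZero of ~~ isect_pos e f & ~~ isect_pos f e : isect_spec e f 0.

Lemma isectP e f : isect_spec e f (isect e f).
Proof.
rewrite /isect; case h1 : (isect_pos e f).
  by rewrite (isect_posN h1) subr0; case/and4P: h1 => *; constructor.
case h2 : (isect_pos f e); last by rewrite subr0; constructor; rewrite ?h1 ?h2.
by rewrite sub0r; case/and4P: h2 => *; constructor.
Qed.

Lemma isect_adjacent a b c : isect (a, b) (b, c) = 0.
Proof.
have o : orient a b b = 0 by rewrite /orient; ring.
by case: isectP => //=; rewrite o ltxx.
Qed.

Lemma pt_on0 e : pt_on e 0 = e.1.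
Proof. by case: e => -[? ?] [? ?]; rewrite /pt_on /=; congr pair; ring. Qed.

Lemma pt_on1 e : pt_on e 1 = e.2.
Proof. by case: e => -[? ?] [? ?]; rewrite /pt_on /=; congr pair; ring. Qed.

Lemma pt_on_inj e t s : e.1 <> e.2 -> pt_on e t = pt_on e s -> t = s.
Proof.
case: e => -[x0 y0] [x1 y1] /= ne; rewrite /pt_on /= => -[E1 E2].
have [//|ts] := eqVneq t s.
have ts0 : t - s != 0 by rewrite subr_eq0.
by case: ne; congr pair; apply: (mulfI ts0); lra.
Qed.

Lemma orient_pt_on f e t : orient f.1 f.2 (pt_on e t) =
  (1 - t) * orient f.1 f.2 e.1 + t * orient f.1 f.2 e.2.
Proof. by rewrite /orient /pt_on /=; ring. Qed.

Lemma orient_self e t : orient e.1 e.2 (pt_on e t) = 0.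
Proof. by rewrite /orient /pt_on /=; ring. Qed.

Lemma orient_sub e f : orient e.1 e.2 f.2 - orient e.1 e.2 f.1 =
  orient f.1 f.2 e.1 - orient f.1 f.2 e.2.
Proof. by rewrite /orient /=; ring. Qed.

Lemma isect_orient_neq e f : isect e f != 0 ->
  orient f.1 f.2 e.1 - orient f.1 f.2 e.2 != 0.
Proof. by case: isectP => // *; apply/eqP; lra. Qed.

Lemma cparam_itv e f : isect e f != 0 -> 0 < cparam e f < 1.
Proof.
rewrite /cparam; case: isectP => // _ _ h1 h2 _.
  by rewrite divr_gt0 ?ltr_pdivrMr; lra.
have -> : orient f.1 f.2 e.1 / (orient f.1 f.2 e.1 - orient f.1 f.2 e.2) =
  (- orient f.1 f.2 e.1) / (orient f.1 f.2 e.2 - orient f.1 f.2 e.1).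
  by rewrite -(opprB (orient f.1 f.2 e.1)) invrN mulrNN.
by rewrite divr_gt0 ?ltr_pdivrMr; lra.
Qed.

Lemma cparam_itvW e f : isect e f != 0 -> 0 <= cparam e f <= 1.
Proof. by case/cparam_itv/andP => /ltW -> /ltW ->. Qed.

Lemma isect_neqC e f : (isect f e != 0) = (isect e f != 0).
Proof. by rewrite isectC oppr_eq0. Qed.

Lemma pt_on_cparam e f : isect e f != 0 ->
  pt_on e (cparam e f) = pt_on f (cparam f e).
Proof.
move=> ef; have n1 := isect_orient_neq ef.
have n2 : orient e.1 e.2 f.1 - orient e.1 e.2 f.2 != 0.
  by apply: isect_orient_neq; rewrite isect_neqC.
move: n1 n2; rewrite /pt_on /cparam /orient.
case: e f {ef} => -[x0 y0] [x1 y1] [[x2 y2] [x3 y3]] /= n1 n2.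
congr pair; field; rewrite ?n1 ?n2 //.
Qed.

Lemma isect_crosses e f : isect e f != 0 -> crosses e f.
Proof.
move=> ef; split; first by move=> E; rewrite E isectxx eqxx in ef.
exists (pt_on e (cparam e f)); split.
  by exists (cparam e f) => //; exact: cparam_itv.
exists (cparam f e); first by apply: cparam_itv; rewrite isect_neqC.
exact: pt_on_cparam.
Qed.

Lemma collinear_param (P Q X : pt R) : P <> Q -> orient P Q X = 0 ->
  exists t, X = pt_on (P, Q) t.
Proof.
case: P Q X => [x0 y0] [x1 y1] [x y]; rewrite /orient /pt_on /= => ne o.
have [dx|dx] := eqVneq (x1 - x0) 0.
  have dy : y1 - y0 != 0.
    by apply/eqP => dy; case: ne; congr pair; lra.
  exists ((y - y0) / (y1 - y0)); congr pair; last by field.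
  have -> : x1 = x0 by lra.
  rewrite dx in o; have : x - x0 = 0 by apply: (mulfI dy); lra.
  by move=> h; transitivity x0; [lra | ring].
exists ((x - x0) / (x1 - x0)); congr pair; first by field.
apply: (mulfI dx); transitivity (y0 * (x1 - x0) + (y1 - y0) * (x - x0)).
  lra.
by field.
Qed.

Lemma pt_on_pt_on e (a b t : R) :
  pt_on (pt_on e a, pt_on e b) t = pt_on e ((1 - t) * a + t * b).
Proof. by rewrite /pt_on /=; congr pair; ring. Qed.

End Plane.

Lemma map_uniq_inj (S U : eqType) (F : S -> U) (l : seq S) x y :
  uniq (map F l) -> x \in l -> y \in l -> F x = F y -> x = y.
Proof.
elim: l => [//|z l IH] /= /andP[zl u]; rewrite !inE => /predU1P[->|xl] /predU1P[->|yl] E //.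
- by rewrite E map_f in zl.
- by rewrite -E map_f in zl.
- exact: IH.
Qed.

(** * Crossings of polygons in general position *)

Section GenericPolygons.
Variables (R : realType) (E : seq (edge R)).
Hypotheses (Ecl : closed_polygons E) (Egen : generic E).
Implicit Types (e f g : edge R).

Lemma source_inj e f : e \in E -> f \in E -> e.1 = f.1 -> e = f.
Proof. by have [u _] := Ecl; exact: map_uniq_inj. Qed.

Lemma target_inj e f : e \in E -> f \in E -> e.2 = f.2 -> e = f.
Proof. by have [u p] := Ecl; rewrite (perm_uniq p) in u; exact: map_uniq_inj. Qed.

Lemma target_source e : e \in E -> exists2 f, f \in E & f.1 = e.2.
Proof.
have [_ p] := Ecl => eE.
have : e.2 \in unzip1 E by rewrite (perm_mem p) map_f.
by case/mapP => f fE ->; exists f.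
Qed.

Lemma on_seg_source e f : e \in E -> f \in E ->
  on_seg f.1 e -> f.1 = e.1 \/ f.1 = e.2.
Proof. by case: Egen => _ _ h _; exact: h. Qed.

Lemma on_seg_target e f : e \in E -> f \in E ->
  on_seg f.2 e -> f.2 = e.1 \/ f.2 = e.2.
Proof.
by move=> eE fE; have [g gE <-] := target_source fE; exact: on_seg_source.
Qed.

Lemma edge_neq e : e \in E -> e.1 <> e.2.
Proof. by case: Egen => h _ _ _; exact: h. Qed.

Lemma pt_on_neq_ends e t : e \in E -> 0 < t < 1 ->
  pt_on e t <> e.1 /\ pt_on e t <> e.2.
Proof.
move=> eE t01; have ne := edge_neq eE.
split; first by rewrite -(pt_on0 e) => /(pt_on_inj ne); lra.
by rewrite -(pt_on1 e) => /(pt_on_inj ne); lra.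
Qed.

(* Two collinear edges with a common interior point would put an endpoint of  *)
(* one of them on the other.                                                  *)
Lemma crosses_isect e f : e \in E -> f \in E -> crosses e f -> isect e f != 0.
Proof.
move=> eE fE [ef [x [[t t01 xt] [s s01 xs]]]].
have ne := edge_neq eE; have nf := edge_neq fE.
have H1 : (1 - s) * orient e.1 e.2 f.1 + s * orient e.1 e.2 f.2 = 0.
  by rewrite -orient_pt_on -xs xt orient_self.
have H2 : (1 - t) * orient f.1 f.2 e.1 + t * orient f.1 f.2 e.2 = 0.
  by rewrite -orient_pt_on -xt xs orient_self.
have H3 := orient_sub e f.
(* Collinear case: [f] runs from parameter [a] to parameter [b] of [e]. An end of one edge on the
   other must be a common vertex, which gives [a = 1] or [b = 0]; both at once would make [f] the
   reverse of [e]. *)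
have [c0|c0] := eqVneq (orient e.1 e.2 f.1) 0.
  have d0 : orient e.1 e.2 f.2 = 0.
    have s0 : s != 0 by rewrite gt_eqF//; case/andP: s01.
    by move: H1; rewrite c0 mulr0 add0r => H1; apply: (mulfI s0); rewrite H1 mulr0.
  have [a fa] := collinear_param ne c0; have [b fb] := collinear_param ne d0.
  have pe u : pt_on (e.1, e.2) u = pt_on e u by [].
  rewrite !pe in fa fb.
  have ft u : pt_on f u = pt_on e ((1 - u) * a + u * b).
    by rewrite -pt_on_pt_on -fa -fb; case: (f).
  have tE : t = (1 - s) * a + s * b.
    by apply: (pt_on_inj ne); rewrite -xt xs ft.
  have ab : a <> b by move=> ab; apply: nf; rewrite fa fb ab.
  have on1 : on_seg f.1 e -> a = 1.
    move=> h; case: (on_seg_source eE fE h) => h'.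
      by case: ef; apply: source_inj.
    by apply: (pt_on_inj ne); rewrite -fa pt_on1.
  have on2 : on_seg f.2 e -> b = 0.
    move=> h; case: (on_seg_target eE fE h) => h'.
      by apply: (pt_on_inj ne); rewrite -fb pt_on0.
    by case: ef; apply: target_inj.
  have on3 : on_seg e.1 f -> b = 0.
    move=> h; case: (on_seg_source fE eE h) => h'.
      by case: ef; apply: source_inj.
    by apply: (pt_on_inj ne); rewrite -fb pt_on0.
  have on4 : on_seg e.2 f -> a = 1.
    move=> h; case: (on_seg_target fE eE h) => h'.
      by apply: (pt_on_inj ne); rewrite -fa pt_on1.
    by case: ef; apply: target_inj.
  have onf u : (0 <= (u - a) / (b - a) <= 1) -> on_seg (pt_on e u) f.
    move=> h; exists ((u - a) / (b - a)) => //; rewrite ft; congr pt_on.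
    by field; apply/eqP; lra.
  have onf' u : (a <= u <= b) || (b <= u <= a) -> on_seg (pt_on e u) f.
    move=> h; apply: onf; have [ltab|] := ltP a b.
      have ba : 0 < b - a by lra.
      by rewrite ler_pdivlMr// ler_pdivrMr//; lra.
    move=> leba; have ba : b - a < 0 by lra.
    by rewrite ler_ndivlMr// ler_ndivrMr//; lra.
  have [_ rev _ _] := Egen.
  have norev : ~ (a = 1 /\ b = 0).
    move=> [a1 b0]; move: (rev _ eE) => /negP; apply.
    have -> // : (e.2, e.1) = f.
    by rewrite -(pt_on0 e) -(pt_on1 e) -a1 -b0 -fa -fb; case: (f).
  exfalso.
  have [s0 s1] : 0 < s /\ 0 < 1 - s by lra.
  have I1 : (0 <= a <= 1) -> a = 1 by move=> h; apply: on1; exists a.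
  have I2 : (0 <= b <= 1) -> b = 0 by move=> h; apply: on2; exists b.
  have I3 : (a <= 0 <= b) || (b <= 0 <= a) -> b = 0.
    by move=> h; apply: on3; rewrite -(pt_on0 e); exact: onf'.
  have I4 : (a <= 1 <= b) || (b <= 1 <= a) -> a = 1.
    by move=> h; apply: on4; rewrite -(pt_on1 e); exact: onf'.
  have sa : a < b -> a < t < b by move=> lab; have := mulr_gt0 s0 s1; nra.
  have sb : b < a -> b < t < a by move=> lab; have := mulr_gt0 s0 s1; nra.
  case: (ltgtP a b) => [lab|lba|//].
    have := sa lab => tb; have [a0|a0] := leP a 0.
      by have := I3 ltac:(lra); lra.
    by have := I1 ltac:(lra); lra.
  have := sb lba => tb; have [b1|b1] := leP b 0.
    have := I3 ltac:(lra) => b0; have [a1|a1] := leP a 1.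
      by apply: norev; split=> //; apply: I1; lra.
    by have := I4 ltac:(lra); lra.
  by have := I2 ltac:(lra); lra.
have sl : (0 < s) && (0 < 1 - s) by lra.
have tl : (0 < t) && (0 < 1 - t) by lra.
case/andP: sl => s0 s1; case/andP: tl => t0 t1.
have opp (u p q : R) : 0 < u -> 0 < 1 - u -> (1 - u) * p + u * q = 0 -> p != 0 ->
    p < 0 < q \/ q < 0 < p.
  move=> u0 u1 h p0; have [pn|pp] : p < 0 \/ 0 < p by move: p0; rewrite neq_lt => /orP.
    left; rewrite pn /=; rewrite -(pmulr_rgt0 _ u0).
    by have := mulr_gt0 u1 (_ : 0 < - p); nra.
  right; rewrite pp andbT -(pmulr_rlt0 _ u0).
  by have := mulr_gt0 u1 pp; lra.
have c1 := opp _ _ _ s0 s1 H1 c0.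
have e0 : orient f.1 f.2 e.1 != 0.
  apply/eqP => e0; have e20 : orient f.1 f.2 e.2 = 0.
    by move: H2; rewrite e0 mulr0 add0r => H2; apply: (mulfI (lt0r_neq0 t0)); rewrite H2 mulr0.
  have H0 : orient e.1 e.2 f.2 = orient e.1 e.2 f.1 by lra.
  by rewrite H0 in c1; case: c1 => /andP[/lt_trans h /h]; rewrite ltxx.
have c2 := opp _ _ _ t0 t1 H2 e0.
case: isectP => // /negP h1 /negP h2; exfalso.
case: c1 => /andP[p1 p2]; case: c2 => /andP[p3 p4].
- by clear ef ne nf; lra.
- by apply: h1; apply/and4P.
- by apply: h2; apply/and4P.
- by clear ef ne nf; lra.
Qed.

End GenericPolygons.

(** * Winding numbers *)

Section Winding.
Variable R : realType.
Implicit Types (a b c v w P Q : pt R) (e f : edge R).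

(* Signed crossings of [e] with the vertical ray going up from [v] and of the *)
(* vertical ray going up to [P] with [f].  The half-open conventions amount   *)
(* to moving [v] and [f] infinitesimally to the right.                        *)
Definition ray_above v e : int :=
  [&& e.1.1 <= v.1, v.1 < e.2.1 & orient e.1 e.2 v < 0]%:Z -
  [&& e.2.1 <= v.1, v.1 < e.1.1 & 0 < orient e.1 e.2 v]%:Z.

Definition ray_below P f : int :=
  [&& f.1.1 < P.1, P.1 <= f.2.1 & 0 < orient f.1 f.2 P]%:Z -
  [&& f.2.1 < P.1, P.1 <= f.1.1 & orient f.1 f.2 P < 0]%:Z.

Lemma orient_swap a b c : orient b a c = - orient a b c.
Proof. by rewrite /orient; ring. Qed.

Lemma isect_swapl v w e : isect (w, v) e = - isect (v, w) e.
Proof.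
rewrite /isect /isect_pos /= !(orient_swap v w) !oppr_lt0 !oppr_gt0 opprB.
congr ((nat_of_bool _)%:Z - (nat_of_bool _)%:Z).
  by case: (_ < _); case: (_ < _); rewrite ?andbT ?andbF //= andbC.
by case: (_ < _); case: (_ < _); rewrite ?andbT ?andbF //= andbC.
Qed.

Lemma isect_swapr e P Q : isect e (Q, P) = - isect e (P, Q).
Proof. by rewrite isectC isect_swapl [in RHS]isectC. Qed.

Lemma ray_above_swap v P Q : ray_above v (Q, P) = - ray_above v (P, Q).
Proof.
by rewrite /ray_above /= !(orient_swap P Q) oppr_lt0 oppr_gt0 opprB.
Qed.

Lemma ray_below_swap P v w : ray_below P (w, v) = - ray_below P (v, w).
Proof.
by rewrite /ray_below /= !(orient_swap v w) oppr_lt0 oppr_gt0 opprB.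
Qed.

Lemma on_seg_swap P v w : on_seg P (w, v) -> on_seg P (v, w).
Proof.
case=> t t01 ->; exists (1 - t); first by lra.
by rewrite /pt_on /=; congr pair; ring.
Qed.

Lemma off_seg_orient a b c : ~ on_seg c (a, b) -> a.1 <= c.1 <= b.1 ->
  a.1 < b.1 -> orient a b c != 0.
Proof.
move=> off c01 ab; apply/eqP => o; apply: off.
have ne : a <> b by move=> E; rewrite E ltxx in ab.
have [t ct] := collinear_param ne o; exists t => //.
move: c01; rewrite ct /pt_on /= => /andP[h1 h2].
have d0 : 0 < b.1 - a.1 by lra.
apply/andP; split.
  by rewrite -(pmulr_lge0 _ d0); lra.
by rewrite -subr_ge0 -(pmulr_lge0 _ d0); lra.
Qed.

Lemma off_seg_vertical a b c : ~ on_seg c (a, b) -> a.1 = c.1 -> b.1 = c.1 ->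
  (a.2 < c.2 /\ b.2 < c.2) \/ (c.2 < a.2 /\ c.2 < b.2).
Proof.
case: a b c => [x0 y0] [x1 y1] [x y] /= off E0 E1; subst x0 x1.
have H t : 0 <= t <= 1 -> y <> (1 - t) * y0 + t * y1.
  move=> t01 E; apply: off; exists t => //; rewrite /pt_on /=.
  by congr pair; [ring | exact: E].
have n0 : y <> y0 by move=> E; apply: (H 0); lra.
have n1 : y <> y1 by move=> E; apply: (H 1); lra.
have [E|ne] := eqVneq y1 y0.
  by rewrite E; case: (ltgtP y y0) => // h; [right | left].
have d0 : y1 - y0 != 0 by rewrite subr_eq0.
have {}H : ~ (0 <= (y - y0) / (y1 - y0) <= 1).
  by move=> /H; apply; field.
case: (ltgtP y y0) => // h0; case: (ltgtP y y1) => // h1; try by [left|right].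
  case: H; rewrite ler_ndivlMr ?ler_ndivrMr; lra.
case: H; rewrite ler_pdivlMr ?ler_pdivrMr; lra.
Qed.

(* In the next six lemmas [v], [w], [p], [q] are the abscissas of the         *)
(* endpoints of two segments vw and pq, [o1] and [o2] are the orientations of *)
(* p, q with v and w, and [o3] and [o4] those of v, w with p and q.           *)
Definition segment_orientations (v w p q o1 o2 o3 o4 : R) : Prop :=
  [/\ o4 - o3 = o1 - o2, o1 * w - o2 * v = o4 * p - o3 * q, v <= w & p <= q].

Section Crossing.
Variables (v w p q o1 o2 o3 o4 : R).
Hypothesis vwpq : segment_orientations v w p q o1 o2 o3 o4.

Let mulE1 x : o4 * x - o3 * x = o1 * x - o2 * x.
Proof. by have [E1 _ _ _] := vwpq; rewrite -!mulrBl E1. Qed.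

(** The intersection of the two lines has abscissa [(o1 w - o2 v) / (o1 - o2)], and also
    [(o4 p - o3 q) / (o4 - o3)]; the identities of [segment_orientations] equate the numerators and
    the denominators. Under these signs both are weighted means, one at most [w] and the other at
    least [p]. *)
Lemma no_crossing_left : w < p -> o2 < 0 -> 0 < o1 -> o3 < 0 -> 0 < o4 -> False.
Proof.
have [E1 E2 vw pq] := vwpq.
have Ev := mulE1 v; have Ew := mulE1 w; have Ep := mulE1 p; have Eq := mulE1 q.
move=> wp h2 h1 h3 h4.
have A1 : 0 < o1 * (p - w) by apply: mulr_gt0; lra.
have A2 : 0 < - o2 * (p - v) by apply: mulr_gt0; lra.
have A3 : 0 <= - o3 * (q - p) by apply: mulr_ge0; lra.
lra.
Qed.

(** The comparison of means as on the left, but the half-open conventions only give [q <= v], so two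
    segments on one vertical line are left over. *)
Lemma no_crossing_right : q <= v -> o2 < 0 -> 0 < o1 -> o3 < 0 -> 0 < o4 ->
  [/\ w = q, v = q & p = q].
Proof.
have [E1 E2 vw pq] := vwpq.
have Ev := mulE1 v; have Ew := mulE1 w; have Ep := mulE1 p; have Eq := mulE1 q.
move=> qv h2 h1 h3 h4.
have A1 : 0 <= o1 * (w - q) by apply: mulr_ge0; lra.
have A2 : 0 <= - o2 * (v - q) by apply: mulr_ge0; lra.
have A4 : 0 <= o4 * (q - p) by apply: mulr_ge0; lra.
have B1 : o1 * (w - q) = 0 by lra.
have B2 : o2 * (v - q) = 0 by lra.
have B4 : o4 * (q - p) = 0 by lra.
split; [move: B1 | move: B2 | move: B4] => /eqP; rewrite mulf_eq0 => /orP[] /eqP; lra.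
Qed.

(** The name of each [crossing] lemma lists the two endpoints whose abscissas fall within the range
    of the other segment: only these two contribute ray terms to [isect_ray]. The extra alternative,
    here and in [crossing_vw], is a vertical segment at the edge of that range. *)
Lemma crossing_PQ : v < p -> q <= w -> o3 < 0 -> 0 < o4 ->
  0 < o1 /\ (o2 < 0 \/ p = w /\ q = w).
Proof.
have [E1 E2 vw pq] := vwpq.
have Ev := mulE1 v; have Ew := mulE1 w; have Ep := mulE1 p; have Eq := mulE1 q.
move=> vp qw h3 h4; have vw0 : 0 < w - v by lra.
have A1 : 0 < o4 * (p - v) by apply: mulr_gt0; lra.
have A2 : 0 < - o3 * (q - v) by apply: mulr_gt0; lra.
have A3 : 0 <= o4 * (w - p) by apply: mulr_ge0; lra.
have A4 : 0 <= - o3 * (w - q) by apply: mulr_ge0; lra.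
split; first by rewrite -(pmulr_rgt0 _ vw0); lra.
have [h2|h2] := ltP o2 0; [by left | right].
have A5 : 0 <= o2 * (w - v) by apply: mulr_ge0; lra.
have B3 : o4 * (w - p) = 0 by lra.
have B4 : o3 * (w - q) = 0 by lra.
by split; [move: B3 | move: B4] => /eqP; rewrite mulf_eq0 => /orP[] /eqP; lra.
Qed.

Lemma crossing_Pw : v < p -> p <= w -> w < q -> o3 < 0 -> o2 < 0 ->
  0 < o1 /\ 0 < o4.
Proof.
have [E1 E2 vw pq] := vwpq.
have Ev := mulE1 v; have Ew := mulE1 w; have Ep := mulE1 p; have Eq := mulE1 q.
move=> vp pw wq h3 h2.
have A1 : 0 < - o3 * (q - p) by apply: mulr_gt0; lra.
have A2 : 0 < - o2 * (p - v) by apply: mulr_gt0; lra.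
have A3 : 0 < - o3 * (q - w) by apply: mulr_gt0; lra.
have A4 : 0 < - o2 * (w - v) by apply: mulr_gt0; lra.
have B1 : 0 < (w - p) * o1 by lra.
have B4 : 0 < (w - p) * o4 by lra.
have wp : 0 < w - p.
  by rewrite lt0r subr_ge0 pw andbT; apply: contraTneq B1 => ->; rewrite mul0r ltxx.
by rewrite -(pmulr_rgt0 _ wp) -(pmulr_rgt0 o4 wp).
Qed.

Lemma crossing_vQ : p <= v -> v < q -> q <= w -> 0 < o1 -> 0 < o4 ->
  o2 < 0 /\ o3 < 0.
Proof.
have [E1 E2 vw pq] := vwpq.
have Ev := mulE1 v; have Ew := mulE1 w; have Ep := mulE1 p; have Eq := mulE1 q.
move=> pv vq qw h1 h4.
have A1 : 0 < o1 * (w - v) by apply: mulr_gt0; lra.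
have A2 : 0 <= o4 * (v - p) by apply: mulr_ge0; lra.
have A3 : 0 <= o1 * (w - q) by apply: mulr_ge0; lra.
have A4 : 0 < o4 * (q - p) by apply: mulr_gt0; lra.
have B1 : (q - v) * o3 < 0 by lra.
have B2 : (q - v) * o2 < 0 by lra.
have vq0 : 0 < q - v by lra.
by rewrite -(pmulr_rlt0 _ vq0) -(pmulr_rlt0 o3 vq0).
Qed.

Lemma crossing_vw : p <= v -> w < q -> 0 < o1 -> o2 < 0 ->
  0 < o4 /\ (o3 < 0 \/ v = p /\ w = p).
Proof.
have [E1 E2 vw pq] := vwpq.
have Ev := mulE1 v; have Ew := mulE1 w; have Ep := mulE1 p; have Eq := mulE1 q.
move=> pv wq h1 h2.
have A1 : 0 < o1 * (q - w) by apply: mulr_gt0; lra.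
have A2 : 0 < - o2 * (q - v) by apply: mulr_gt0; lra.
have A3 : 0 <= o1 * (w - p) by apply: mulr_ge0; lra.
have A4 : 0 <= - o2 * (v - p) by apply: mulr_ge0; lra.
have pq0 : 0 < q - p by lra.
split; first by rewrite -(pmulr_rgt0 _ pq0); lra.
have [h3|h3] := ltP o3 0; [by left | right].
have A5 : 0 <= o3 * (q - p) by apply: mulr_ge0; lra.
have B3 : o1 * (w - p) = 0 by lra.
have B4 : o2 * (v - p) = 0 by lra.
by split; [move: B4 | move: B3] => /eqP; rewrite mulf_eq0 => /orP[] /eqP; lra.
Qed.

End Crossing.

End Winding.

(** * The intersection sign as a difference of ray counts *)

Section IsectRay.
Variable R : realType.
Implicit Types (a b c v w P Q : pt R) (e f : edge R).

(** A vertical segment on the vertical line through [c] that misses [c] lies entirely above or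
    entirely below it, hence on one side of the line [uc]. This excludes the vertical alternatives
    of [crossing_PQ] and [crossing_vw]. *)
Lemma off_seg_vertical_orient a b c u : ~ on_seg c (a, b) ->
  a.1 = c.1 -> b.1 = c.1 -> u.1 <> c.1 -> 0 < orient u c a * orient u c b.
Proof.
move=> off ac bc uc.
have -> : orient u c a = (c.1 - u.1) * (a.2 - c.2) by rewrite /orient ac; ring.
have -> : orient u c b = (c.1 - u.1) * (b.2 - c.2) by rewrite /orient bc; ring.
rewrite mulrACA pmulr_rgt0; last first.
  by rewrite -expr2 exprn_even_gt0//= subr_eq0; apply/eqP => /esym.
case: (off_seg_vertical off ac bc) => -[h1 h2].
  by rewrite nmulr_rgt0 subr_lt0.
by rewrite mulr_gt0 ?subr_gt0.
Qed.

(** Changing all signs carries the lemmas on positive crossings over to negative ones. *)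
Lemma segment_orientationsN (v w p q o1 o2 o3 o4 : R) :
  segment_orientations v w p q o1 o2 o3 o4 ->
  segment_orientations v w p q (- o1) (- o2) (- o3) (- o4).
Proof. by case=> E1 E2 vw pq; split=> //; lra. Qed.

Lemma isect_eq1 e f : orient e.1 e.2 f.1 < 0 -> 0 < orient e.1 e.2 f.2 ->
  orient f.1 f.2 e.2 < 0 -> 0 < orient f.1 f.2 e.1 -> isect e f = 1.
Proof.
move=> h1 h2 h3 h4; case: isectP => // [/(lt_trans h2)|/negP[]].
  by rewrite ltxx.
exact/and4P.
Qed.

Lemma isect_eqN1 e f : orient e.1 e.2 f.2 < 0 -> 0 < orient e.1 e.2 f.1 ->
  orient f.1 f.2 e.1 < 0 -> 0 < orient f.1 f.2 e.2 -> isect e f = -1.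
Proof. by move=> *; rewrite isectC isect_eq1. Qed.

Lemma isect_sides v w P Q : isect (v, w) (P, Q) != 0 ->
  (orient v w P < 0 /\ 0 < orient v w Q /\ orient P Q w < 0 /\ 0 < orient P Q v) \/
  (orient v w Q < 0 /\ 0 < orient v w P /\ orient P Q v < 0 /\ 0 < orient P Q w).
Proof. by case: isectP => //= *; [left | right]. Qed.

(** For [v] to the left of [w], consider the region above [vw], bounded by [vw] and the upward rays
    from [v] and [w]. The [ray_below] terms tell whether [Q] and [P] lie in it, so their difference
    is the net number of entries of [PQ]; these take place through [vw], counted by [isect], or
    through one of the two rays. *)
Lemma isect_ray v w P Q :
  ~ on_seg v (P, Q) -> ~ on_seg w (P, Q) ->
  ~ on_seg P (v, w) -> ~ on_seg Q (v, w) ->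
  isect (v, w) (P, Q) =
  ray_above w (P, Q) - ray_above v (P, Q) +
  (ray_below Q (v, w) - ray_below P (v, w)).
Proof.
wlog vw : v w / v.1 <= w.1.
  move=> H nv nw nP nQ; have [|/ltW] := leP v.1 w.1; first by move/H; apply.
  move/H => /(_ nw nv); rewrite isect_swapl !(ray_below_swap _ v w) => E.
  rewrite -[LHS]opprK E; first by ring.
    by move=> h; apply: nP; exact: on_seg_swap.
  by move=> h; apply: nQ; exact: on_seg_swap.
wlog PQ : P Q / P.1 <= Q.1.
  move=> H nv nw nP nQ; have [|/ltW] := leP P.1 Q.1; first by move/H; apply.
  move/H; rewrite isect_swapr !(ray_above_swap _ P Q) => E.
  rewrite -[LHS]opprK E //; first by ring.
    by move=> h; apply: nv; exact: on_seg_swap.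
  by move=> h; apply: nw; exact: on_seg_swap.
move=> nv nw nP nQ.
have SO : segment_orientations v.1 w.1 P.1 Q.1 (orient P Q v) (orient P Q w)
    (orient v w P) (orient v w Q).
  split=> //; last by rewrite /orient; ring.
  exact: orient_sub (v, w) (P, Q).
have SN := segment_orientationsN SO.
have Ng (x : R) : x < 0 -> 0 < - x by rewrite oppr_gt0.
have Nl (x : R) : 0 < x -> - x < 0 by rewrite oppr_lt0.
have bF1 (b1 b2 b3 : bool) : ~~ b1 -> [&& b1, b2 & b3] = false.
  by move/negbTE=> ->.
have bF2 (b1 b2 b3 : bool) : ~~ b2 -> [&& b1, b2 & b3] = false.
  by move/negbTE=> ->; rewrite andbF.
have bF (b1 b2 b3 : bool) : (b1 -> b2 -> False) -> [&& b1, b2 & b3] = false.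
  by case: b1 b2 => [] [] // /(_ isT isT).
have -> : ray_above w (P, Q) = [&& P.1 <= w.1, w.1 < Q.1 & orient P Q w < 0]%:Z.
  rewrite /ray_above /= [X in _ - (nat_of_bool X)%:Z]bF ?subr0// => h1 h2.
  by have := lt_le_trans h2 (le_trans PQ h1); rewrite ltxx.
have -> : ray_above v (P, Q) = [&& P.1 <= v.1, v.1 < Q.1 & orient P Q v < 0]%:Z.
  rewrite /ray_above /= [X in _ - (nat_of_bool X)%:Z]bF ?subr0// => h1 h2.
  by have := lt_le_trans h2 (le_trans PQ h1); rewrite ltxx.
have -> : ray_below P (v, w) = [&& v.1 < P.1, P.1 <= w.1 & 0 < orient v w P]%:Z.
  rewrite /ray_below /= [X in _ - (nat_of_bool X)%:Z]bF ?subr0// => h1 h2.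
  by have := lt_le_trans h1 (le_trans h2 vw); rewrite ltxx.
have -> : ray_below Q (v, w) = [&& v.1 < Q.1, Q.1 <= w.1 & 0 < orient v w Q]%:Z.
  rewrite /ray_below /= [X in _ - (nat_of_bool X)%:Z]bF ?subr0// => h1 h2.
  by have := lt_le_trans h1 (le_trans h2 vw); rewrite ltxx.
have I0 : (isect (v, w) (P, Q) != 0 -> False) -> isect (v, w) (P, Q) = 0.
  by move=> h; apply/eqP/negPn/negP.
have asym (x : R) : x < 0 -> 0 < x -> False.
  by move=> h /(lt_trans h); rewrite ltxx.
have sg (x : R) : x != 0 -> x < 0 \/ 0 < x by rewrite neq_lt => /orP.
have [wP|Pw] := ltP w.1 P.1.
  rewrite !(bF2 (v.1 < _)) -?ltNge ?(lt_le_trans wP) // !bF1 -?ltNge //; last first.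
    exact: le_lt_trans vw wP.
  rewrite !subr0; apply: I0 => /isect_sides[] [h1 [h2 [h3 h4]]].
    exact: (no_crossing_left SO wP).
  by apply: (no_crossing_left SN wP); auto.
have [Qv|vQ] := leP Q.1 v.1.
  rewrite (le_gtF (le_trans PQ Qv)) (le_gtF (le_trans Qv vw)) [RHS](_ : _ = 0); last by rewrite !andbF.
  apply: I0 => ho; have h := isect_sides ho.
  have [E1 E2 E3] : [/\ w.1 = Q.1, v.1 = Q.1 & P.1 = Q.1].
    case: h => [] [h1 [h2 [h3 h4]]]; first exact: (no_crossing_right SO Qv).
    by apply: (no_crossing_right SN Qv); auto.
  have o3 : orient v w P = 0 by rewrite /orient E1 E2 E3; ring.
  have o4 : orient v w Q = 0 by rewrite /orient E1 E2; ring.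
  by move: h; rewrite o3 o4 ltxx => -[] [].
(* The ranges of abscissas overlap and can interleave in four ways. Each leaves two ray terms,
   settled by the [crossing] lemma named after them: applied to [SO] for sign 1, to [SN] for sign
   -1. *)
have [vP|Pv] := ltP v.1 P.1; have [Qw|wQ] := leP Q.1 w.1.
- have vw' := lt_le_trans vP Pw.
  have := off_seg_orient nP; rewrite /= (ltW vP) Pw => /(_ isT vw') o3.
  have := off_seg_orient nQ; rewrite /= (ltW vQ) Qw => /(_ isT vw') o4.
  have vert : P.1 = w.1 -> Q.1 = w.1 -> 0 < orient v w P * orient v w Q.
    move=> h1 h2; apply: off_seg_vertical_orient h1 h2 _ => //.
    by move=> E; rewrite E ltxx in vw'.
  rewrite /= ?subr0 ?sub0r ?add0r.
  case: (sg _ o3) => h3; case: (sg _ o4) => h4; rewrite ?h3 ?h4 ?(lt_gtF h3) ?(lt_gtF h4) /=.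
  + by apply: I0 => /isect_sides[] [k1 [k2 _]]; [exact: asym h4 k2 | exact: asym h3 k2].
  + have [h1 [h2|[E1 E2]]] := crossing_PQ SO vP Qw h3 h4; first exact: isect_eq1.
    by have := vert E1 E2; rewrite nmulr_rgt0// (lt_gtF h4).
  + have [] := crossing_PQ SN vP Qw (Nl _ h3) (Ng _ h4); rewrite oppr_gt0 oppr_lt0.
    move=> h1 [h2|[E1 E2]]; first exact: isect_eqN1.
    by have := vert E1 E2; rewrite pmulr_rgt0// (lt_gtF h4).
  + by apply: I0 => /isect_sides[] [k1 _]; [exact: asym k1 h3 | exact: asym k1 h4].
- have vw' := lt_le_trans vP Pw; have PQ' := le_lt_trans Pw wQ.
  have := off_seg_orient nP; rewrite /= (ltW vP) Pw => /(_ isT vw') o3.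
  have := off_seg_orient nw; rewrite /= Pw (ltW wQ) => /(_ isT PQ') o2.
  rewrite /= ?subr0 ?sub0r ?add0r.
  case: (sg _ o3) => h3; case: (sg _ o2) => h2; rewrite ?h3 ?h2 ?(lt_gtF h3) ?(lt_gtF h2) /=.
  + by have [h1 h4] := crossing_Pw SO vP Pw wQ h3 h2; exact: isect_eq1.
  + by apply: I0 => /isect_sides[] [_ [k2 [k3 _]]]; [exact: asym k3 h2 | exact: asym h3 k2].
  + by apply: I0 => /isect_sides[] [k1 [_ [_ k4]]]; [exact: asym k1 h3 | exact: asym h2 k4].
  + have := crossing_Pw SN vP Pw wQ (Nl _ h3) (Nl _ h2); rewrite !oppr_gt0.
    by case=> h1 h4; exact: isect_eqN1.
- have vw' := lt_le_trans vQ Qw; have PQ' := le_lt_trans Pv vQ.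
  have := off_seg_orient nv; rewrite /= Pv (ltW vQ) => /(_ isT PQ') o1.
  have := off_seg_orient nQ; rewrite /= (ltW vQ) Qw => /(_ isT vw') o4.
  rewrite /= ?subr0 ?sub0r ?add0r.
  case: (sg _ o1) => h1; case: (sg _ o4) => h4; rewrite ?h1 ?h4 ?(lt_gtF h1) ?(lt_gtF h4) /=.
  + have := crossing_vQ SN Pv vQ Qw (Ng _ h1) (Ng _ h4); rewrite !oppr_lt0.
    by case=> h2 h3; exact: isect_eqN1.
  + by apply: I0 => /isect_sides[] [k1 [_ [_ k4]]]; [exact: asym h1 k4 | exact: asym k1 h4].
  + by apply: I0 => /isect_sides[] [_ [k2 [k3 _]]]; [exact: asym h4 k2 | exact: asym k3 h1].
  + by have [h2 h3] := crossing_vQ SO Pv vQ Qw h1 h4; exact: isect_eq1.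
- have PQ' := le_lt_trans Pv vQ.
  have := off_seg_orient nv; rewrite /= Pv (ltW vQ) => /(_ isT PQ') o1.
  have := off_seg_orient nw; rewrite /= Pw (ltW wQ) => /(_ isT PQ') o2.
  have vert : v.1 = P.1 -> w.1 = P.1 -> 0 < orient P Q v * orient P Q w.
    move=> h1 h2; rewrite !(orient_swap Q P) mulrNN.
    apply: off_seg_vertical_orient h1 h2 _ => //.
    by move=> E; rewrite E ltxx in PQ'.
  rewrite /= ?subr0 ?sub0r ?add0r.
  case: (sg _ o1) => h1; case: (sg _ o2) => h2; rewrite ?h1 ?h2 ?(lt_gtF h1) ?(lt_gtF h2) /=.
  + by apply: I0 => /isect_sides[] [_ [_ [k3 k4]]]; [exact: asym h1 k4 | exact: asym h2 k4].
  + have [] := crossing_vw SN Pv wQ (Ng _ h1) (Nl _ h2); rewrite oppr_gt0 oppr_lt0.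
    move=> h4 [h3|[E1 E2]]; first exact: isect_eqN1.
    by have := vert E1 E2; rewrite nmulr_rgt0// (lt_gtF h2).
  + have [h4 [h3|[E1 E2]]] := crossing_vw SO Pv wQ h1 h2; first exact: isect_eq1.
    by have := vert E1 E2; rewrite pmulr_rgt0// (lt_gtF h2).
  + by apply: I0 => /isect_sides[] [_ [_ [k3 _]]]; [exact: asym k3 h2 | exact: asym k3 h1].
Qed.

End IsectRay.

(** * Labellings and the index count *)

Section Redraw.
Variable R : realType.
Implicit Types (A B C v : pt R) (s : seq (pt R)) (E F : seq (edge R)).

Lemma chain_cons A C s B : chain A (C :: s) B = (A, C) :: chain C s B.
Proof. by []. Qed.

Lemma chain_nil A B : chain A [::] B = [:: (A, B)].
Proof. by []. Qed.

Lemma unzip1_chain A s B : unzip1 (chain A s B) = A :: s.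
Proof. by rewrite /chain unzip1_zip //= size_rcons. Qed.

Lemma unzip2_chain A s B : unzip2 (chain A s B) = rcons s B.
Proof. by rewrite /chain unzip2_zip //= size_rcons. Qed.

Lemma chain_source A s B e : e \in chain A s B -> e.1 \in A :: s.
Proof. by move=> eC; rewrite -(unzip1_chain A s B) map_f. Qed.

Lemma chain_target A s B e : e \in chain A s B -> e.2 \in B :: s.
Proof. by move=> eC; rewrite -mem_rcons -(unzip2_chain A s B) map_f. Qed.

(** The increments are propagated from [A] along the strand; the only obstruction is the value on
    arrival at [B]. *)
Lemma chain_extend (V : zmodType) A s B (H : pt R -> V) (a : edge R -> V) :
  uniq s -> A \notin s -> B \notin s ->
  H B = H A + \sum_(e <- chain A s B) a e ->
  exists H' : pt R -> V, (forall v, v \notin s -> H' v = H v) /\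
    forall e, e \in chain A s B -> H' e.2 = H' e.1 + a e.
Proof.
elim: s A H => [|C s IH] A H.
  rewrite chain_nil big_seq1 => _ _ _ E; exists H; split=> // e.
  by rewrite inE => /eqP ->.
rewrite chain_cons big_cons /= !inE !negb_or.
move=> /andP[Cs us] /andP[AC As] /andP[BC Bs] HB.
pose H1 v := if v == C then H A + a (A, C) else H v.
have [|H' [HH' Ha]] := IH C H1 us Cs Bs.
  by rewrite /H1 eqxx (negbTE BC) HB addrA.
exists H'; split=> [v|e].
  by rewrite inE negb_or => /andP[vC /HH' ->]; rewrite /H1 (negbTE vC).
rewrite inE => /orP[/eqP -> /=|/Ha//].
by rewrite !HH'// /H1 eqxx (negbTE AC).
Qed.

Section Vertices.
Variables (A B : pt R) (s : seq (pt R)) (E F : seq (edge R)).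
Hypotheses (Ecl : closed_polygons E) (EF : perm_eq E (chain A s B ++ F)).

Lemma redraw_uniq : uniq (A :: s ++ unzip1 F).
Proof.
have [u _] := Ecl; rewrite (perm_uniq (perm_map _ EF)) map_cat in u.
by move: u; rewrite -[map _ (chain _ _ _)]/(unzip1 _) unzip1_chain.
Qed.

(** The rest [F] consists of a path from [B] back to [A] and of closed polygons. This is why the
    increments over [F] telescope to [H A - H B] in [redraw_sum]. *)
Lemma redraw_perm : perm_eq (A :: unzip1 F) (B :: unzip2 F).
Proof.
have [_ p] := Ecl.
have h1 : perm_eq (unzip1 E) (A :: s ++ unzip1 F).
  by have := perm_map fst EF; rewrite map_cat -[map _ (chain _ _ _)]/(unzip1 _) unzip1_chain.
have h2 : perm_eq (unzip2 E) (rcons s B ++ unzip2 F).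
  by have := perm_map snd EF; rewrite map_cat -[map _ (chain _ _ _)]/(unzip2 _) unzip2_chain.
have : perm_eq (A :: s ++ unzip1 F) (rcons s B ++ unzip2 F).
  by rewrite -(permPl h1) -(permPr h2).
rewrite cat_rcons -cat_cons -cat1s -catA perm_catCA perm_cat2l.
by [].
Qed.

Lemma redraw_source_notin v : v \in A :: s -> v \notin unzip1 F.
Proof.
move: redraw_uniq; rewrite -cat_cons cat_uniq => /and3P[_ /hasPn h _] vs.
by apply/negP => /h /negP; apply.
Qed.

Lemma redraw_inner v : v \in s ->
  [/\ v != A, v != B, v \notin unzip1 F & v \notin unzip2 F].
Proof.
move=> vs; have n1 : v \notin unzip1 F.
  by apply: redraw_source_notin; rewrite inE vs orbT.
have vA : v != A.
  have := redraw_uniq; rewrite /= mem_cat negb_or => /andP[/andP[h _] _].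
  by apply: contraNneq h => <-.
have : v \notin B :: unzip2 F.
  by rewrite -(perm_mem redraw_perm) inE negb_or vA.
by rewrite inE negb_or => /andP[].
Qed.

Lemma redraw_sum (V : zmodType) (H : pt R -> V) :
  \sum_(f <- F) (H f.2 - H f.1) = H A - H B.
Proof.
have : \sum_(v <- A :: unzip1 F) H v = \sum_(v <- B :: unzip2 F) H v.
  exact: perm_big redraw_perm.
rewrite !big_cons !big_map => h.
rewrite big_split /= sumrN; apply/eqP; rewrite subr_eq addrAC eq_sym subr_eq.
by rewrite h addrC.
Qed.

End Vertices.
End Redraw.

(** * The labelling equations and the count of crossings by index *)

Section Labels.
Variables (R : realType) (T : Type) (alpha : T).
Implicit Types (A B C : pt R) (e f g : edge R) (F G : seq (edge R)) (t : R).
Implicit Types (D : diagram R T) (H : pt R -> int).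
Implicit Types (d : edge R -> edge R -> decoration T).

Definition is_alpha (c : decoration T) : bool := `[< c = Virtual alpha >].

Definition alpha_sum d F e t : int :=
  \sum_(f <- F | is_alpha (d e f) && (cparam e f < t)) isect e f.

Definition labelling D H : Prop := forall e, e \in edges D ->
  H e.2 = H e.1 + alpha_sum (deco D) (edges D) e 1.

(* The label of [e] just before its point of parameter [t].                   *)
Definition height D H e t : int := H e.1 + alpha_sum (deco D) (edges D) e t.

Definition deco_sign (c : decoration T) : int :=
  match c with Over => 1 | Under => -1 | Virtual _ => 0 end.

(** With [i] the intersection sign and [h] the difference of heights, multiplying both by
    [deco_sign c] gives the crossing sign and the index, over minus under, in whichever order the
    two strands are listed. *)
Definition weight (k : int) (c : decoration T) (i h : int) : int :=
  deco_sign c * i * (deco_sign c * h == k)%:Z.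

Definition cross_weight k D H e f : int := weight k (deco D e f) (isect e f)
  (height D H e (cparam e f) - height D H f (cparam f e)).

(** The sum is over ordered pairs, so every crossing counts twice. *)
Definition index_count k D H : int :=
  \sum_(e <- edges D) \sum_(f <- edges D) cross_weight k D H e f.

Lemma is_alpha_flip (c : decoration T) : is_alpha (flip c) = is_alpha c.
Proof. by apply/asboolP/asboolP; case: c. Qed.

Lemma deco_sign_flip (c : decoration T) : deco_sign (flip c) = - deco_sign c.
Proof. by case: c. Qed.

Lemma deco_flip_isect D e f : e \in edges D -> f \in edges D ->
  isect e f != 0 -> deco D f e = flip (deco D e f).
Proof. by move=> eD fD /isect_crosses; exact: deco_flip. Qed.

Lemma perm_alpha_sum d F G e t : perm_eq F G -> alpha_sum d F e t = alpha_sum d G e t.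
Proof. exact: perm_big. Qed.

Lemma alpha_sum_cat d F G e t :
  alpha_sum d (F ++ G) e t = alpha_sum d F e t + alpha_sum d G e t.
Proof. exact: big_cat. Qed.

Lemma alpha_sum_cons d f F e t : alpha_sum d (f :: F) e t =
  (if is_alpha (d e f) && (cparam e f < t) then isect e f else 0) + alpha_sum d F e t.
Proof. by rewrite /alpha_sum big_cons; case: ifP => // _; rewrite add0r. Qed.

Lemma alpha_sum_nil d e t : alpha_sum d [::] e t = 0.
Proof. exact: big_nil. Qed.

Lemma eq_alpha_sum d d' F e t t' :
  (forall f, f \in F -> isect e f != 0 ->
     is_alpha (d e f) && (cparam e f < t) = is_alpha (d' e f) && (cparam e f < t')) ->
  alpha_sum d F e t = alpha_sum d' F e t'.
Proof.
move=> h; rewrite /alpha_sum big_mkcond [RHS]big_mkcond /=.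
apply: eq_big_seq => f fF; have [->|n0] := eqVneq (isect e f) 0.
  by rewrite !if_same.
by rewrite h.
Qed.

Lemma alpha_sum_eq0 d F e t :
  (forall f, f \in F -> isect e f != 0 -> ~~ is_alpha (d e f)) ->
  alpha_sum d F e t = 0.
Proof.
move=> h; rewrite /alpha_sum big_mkcond big1_seq// => f /andP[_ fF].
have [->|n0] := eqVneq (isect e f) 0; first by rewrite if_same.
by rewrite (negbTE (h f fF n0)).
Qed.

Lemma alpha_sum0 d F e : alpha_sum d F e 0 = 0.
Proof.
rewrite /alpha_sum big_mkcond big1_seq// => f _.
have [->|n0] := eqVneq (isect e f) 0; first by rewrite if_same.
by rewrite ltNge ltW ?andbF//; case/andP: (cparam_itv n0).
Qed.

Lemma alpha_sum1 d F e : alpha_sum d F e 1 = \sum_(f <- F | is_alpha (d e f)) isect e f.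
Proof.
rewrite /alpha_sum big_mkcond [RHS]big_mkcond /=; apply: eq_bigr => f _.
have [->|n0] := eqVneq (isect e f) 0; first by rewrite !if_same.
by case/andP: (cparam_itv n0) => _ ->; rewrite andbT.
Qed.

Lemma int_eqN0 (i : int) : i = - i -> i = 0.
Proof. by lia. Qed.

(** The two strands of an [alpha]-crossing contribute opposite signs. *)
Lemma alpha_total D : \sum_(e <- edges D) alpha_sum (deco D) (edges D) e 1 = 0.
Proof.
apply: int_eqN0; rewrite -sumrN.
under eq_bigr do rewrite alpha_sum1 big_mkcond.
rewrite exchange_big /=; apply: eq_big_seq => f fD.
rewrite alpha_sum1 [X in - X]big_mkcond -sumrN /=; apply: eq_big_seq => e eD.
rewrite isectC; have [->|n0] := eqVneq (isect f e) 0; first by rewrite !if_same oppr0.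
by rewrite (deco_flip_isect fD eD n0) is_alpha_flip; case: ifP; rewrite ?oppr0.
Qed.

(** Only the equations on [F] have to be solved. By [alpha_total] and [redraw_sum] the total
    increment along the strand is then [H B - H A], which is what [chain_extend] requires. *)
Lemma labelling_extend D A s B F H : perm_eq (edges D) (chain A s B ++ F) ->
  (forall f, f \in F -> H f.2 = H f.1 + alpha_sum (deco D) (edges D) f 1) ->
  exists H', (forall v, v \notin s -> H' v = H v) /\ labelling D H'.
Proof.
move=> DF hF; have cl := edges_closed D.
have inner := redraw_inner cl DF.
have us : uniq s.
  by have := redraw_uniq cl DF; rewrite /= cat_uniq => /andP[_ /and3P[]].
have As : A \notin s by apply/negP => /inner[]; rewrite eqxx.
have Bs : B \notin s by apply/negP => /inner[_]; rewrite eqxx.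
pose a e := alpha_sum (deco D) (edges D) e 1.
have tot : \sum_(e <- chain A s B) a e = H B - H A.
  have := alpha_total D; rewrite (perm_big _ DF) big_cat /=.
  have -> : \sum_(f <- F) alpha_sum (deco D) (edges D) f 1 =
            \sum_(f <- F) (H f.2 - H f.1).
    by apply: eq_big_seq => f /hF ->; rewrite addrC addKr.
  by rewrite (redraw_sum cl DF) => /eqP; rewrite addr_eq0 opprB => /eqP.
have [|H' [h1 h2]] := @chain_extend _ _ A s B H a us As Bs.
  by rewrite tot addrC subrK.
exists H'; split=> // e; rewrite (perm_mem DF) mem_cat => /orP[/h2//|eF].
rewrite !h1 ?hF//; apply/negP => /inner[_ _] /negP h /negP h'.
  by apply: h; rewrite map_f.
by apply: h'; rewrite map_f.
Qed.

Lemma cross_weightC k D H e f : e \in edges D -> f \in edges D ->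
  cross_weight k D H f e = cross_weight k D H e f.
Proof.
move=> eD fD; rewrite /cross_weight /weight isectC.
have [->|n0] := eqVneq (isect e f) 0; first by rewrite !(oppr0, mulr0, mul0r).
rewrite (deco_flip_isect eD fD n0) deco_sign_flip mulrNN.
by rewrite -(opprB (height D H e _)) mulrNN.
Qed.

Lemma weight0 k c h : weight k c 0 h = 0.
Proof. by rewrite /weight mulr0 mul0r. Qed.

Lemma weight_virtual k c i h : weight k (Virtual c) i h = 0.
Proof. by rewrite /weight !mul0r. Qed.

Lemma weight_index0 k c i : k != 0 -> weight k c i 0 = 0.
Proof. by rewrite /weight mulr0 eq_sym => /negbTE ->; rewrite mulr0. Qed.

Lemma index_count_split k D H S F : perm_eq (edges D) (S ++ F) ->
  index_count k D H =
  \sum_(e <- F) \sum_(f <- F) cross_weight k D H e f +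
  (\sum_(e <- S) \sum_(f <- S) cross_weight k D H e f +
  (\sum_(e <- S) \sum_(f <- F) cross_weight k D H e f) *+ 2).
Proof.
move=> DF; rewrite /index_count (perm_big _ DF) /= big_cat /=.
under eq_bigr do rewrite (perm_big _ DF) big_cat /=.
under [X in _ + X]eq_bigr do rewrite (perm_big _ DF) big_cat /=.
rewrite !big_split /= [X in _ + (X + _)](_ : _ =
  \sum_(e <- S) \sum_(f <- F) cross_weight k D H e f); first by rewrite mulr2n; ring.
rewrite exchange_big /=; apply: eq_big_seq => e eS; apply: eq_big_seq => f fF.
by apply: cross_weightC; rewrite (perm_mem DF) mem_cat ?eS ?fF ?orbT.
Qed.

End Labels.

(** * Invariance under the moves *)

Section Transfer.
Variables (R : realType) (T : Type) (alpha : T).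
Implicit Types (A B C v x : pt R) (e f g : edge R) (F S : seq (edge R)) (t : R).
Implicit Types (s : seq (pt R)).
Implicit Types (D : diagram R T) (H : pt R -> int).

Local Notation asum D := (alpha_sum alpha (deco D) (edges D)).
Local Notation lab := (labelling alpha).
Local Notation count := (index_count alpha).
Local Notation cw := (cross_weight alpha).

(** A statement about labellings and not about diagrams, since a labelling is neither unique nor
    certain to exist. Index 0 is excluded because a kink creates a crossing of index 0. *)
Definition transfers D D' : Prop := forall k H, k != 0 -> lab D H ->
  exists2 H', lab D' H' & count k D' H' = count k D H.

Lemma redraw_sym A s s' B F D D' : redraw A s s' B F D D' -> redraw A s' s B F D' D.
Proof. by case=> h1 h2 h3; split=> // e f eF fF c; rewrite h3. Qed.

Lemma redraw_memF A s s' B F D D' f :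
  redraw A s s' B F D D' -> f \in F -> f \in edges D.
Proof. by case=> h1 _ _ fF; rewrite (perm_mem h1) mem_cat fF orbT. Qed.

Lemma redraw_memS A s s' B F D D' f :
  redraw A s s' B F D D' -> f \in chain A s B -> f \in edges D.
Proof. by case=> h1 _ _ fF; rewrite (perm_mem h1) mem_cat fF. Qed.

Lemma redraw_sub A s s' B F D D' : redraw A s s' B F D D' ->
  [/\ {subset chain A s B <= edges D}, {subset F <= edges D},
      {subset chain A s' B <= edges D'} & {subset F <= edges D'}].
Proof.
move=> rd; have rd' := redraw_sym rd; split=> e.
- exact: (redraw_memS rd).
- exact: (redraw_memF rd).
- exact: (redraw_memS rd').
- exact: (redraw_memF rd').
Qed.

Lemma redraw_asum A s s' B F D D' e t : redraw A s s' B F D D' ->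
  asum D e t = alpha_sum alpha (deco D) (chain A s B) e t + alpha_sum alpha (deco D) F e t.
Proof. by case=> h _ _; rewrite (perm_alpha_sum _ _ _ _ h) alpha_sum_cat. Qed.

Lemma redraw_asumF A s s' B F D D' f t : redraw A s s' B F D D' -> f \in F ->
  alpha_sum alpha (deco D') F f t = alpha_sum alpha (deco D) F f t.
Proof.
case=> _ _ h fF; apply: eq_alpha_sum => g gF /isect_crosses c.
by rewrite h.
Qed.

Lemma redraw_endsF A s s' B F D D' f : redraw A s s' B F D D' -> f \in F ->
  [/\ f.1 \notin s, f.2 \notin s, f.1 \notin s' & f.2 \notin s'].
Proof.
move=> [h1 h2 _] fF.
have i1 := redraw_inner (edges_closed D) h1.
have i2 := redraw_inner (edges_closed D') h2.
have [f1 f2] : f.1 \in unzip1 F /\ f.2 \in unzip2 F by split; exact: map_f.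
split; apply/negP.
- by move=> /i1[_ _]; rewrite f1.
- by move=> /i1[_ _ _]; rewrite f2.
- by move=> /i2[_ _]; rewrite f1.
- by move=> /i2[_ _ _]; rewrite f2.
Qed.

Lemma redraw_cross_weight k A s s' B F D D' H H' e f :
  redraw A s s' B F D D' -> e \in F -> f \in F ->
  (isect e f != 0 -> height alpha D H e (cparam e f) - height alpha D H f (cparam f e) =
    height alpha D' H' e (cparam e f) - height alpha D' H' f (cparam f e)) ->
  cw k D' H' e f = cw k D H e f.
Proof.
move=> [_ _ h] eF fF hh; rewrite /cross_weight.
have [->|n0] := eqVneq (isect e f) 0; first by rewrite !weight0.
by rewrite -hh// h//; exact: isect_crosses.
Qed.

(** Common frame of the moves that replace [AB] by [AC], [CB]. If the [alpha]-crossings along [F]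
    are unaffected, the weights within [F] are the same, and only the crossings of the three sides
    with [F] remain to be compared. *)
Lemma insert_transfers A B C F D D' : redraw A [::] [:: C] B F D D' ->
  (forall f, f \in F -> forall t, asum D' f t = asum D f t) ->
  (forall k H H', k != 0 -> lab D H -> lab D' H' ->
    (forall v, v != C -> H' v = H v) ->
    forall f, f \in F -> cw k D H (A, B) f = cw k D' H' (A, C) f + cw k D' H' (C, B) f) ->
  transfers D D' /\ transfers D' D.
Proof.
move=> rd hF hS; have [p1 p2 _] := rd.
have ends f fF := redraw_endsF rd (f := f) fF.
have eqc k H H' : k != 0 -> lab D H -> lab D' H' ->
    (forall v, v != C -> H' v = H v) -> count k D' H' = count k D H.
  move=> k0 lH lH' HH.
  rewrite (index_count_split _ _ _ p1) (index_count_split _ _ _ p2).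
  congr (_ + _).
    apply: eq_big_seq => e eF; apply: eq_big_seq => f fF.
    apply: (redraw_cross_weight _ rd) => // _; rewrite /height !hF//.
    have [_ _ e1 _] := ends e eF; have [_ _ f1 _] := ends f fF.
    by rewrite !HH // -mem_seq1.
  rewrite chain_cons !chain_nil !big_cons !big_nil !addr0.
  rewrite /cross_weight !isectxx (isectC (A, C) (C, B)).
  rewrite isect_adjacent oppr0 !weight0 !addr0 !add0r; congr (_ *+ 2).
  by rewrite -big_split /=; apply: eq_big_seq => f fF; rewrite -(hS k H H').
split=> k H k0 lH.
  have [|H' [h1 h2]] := labelling_extend (alpha := alpha) (H := H) p2.
    by move=> f fF; rewrite hF//; apply: lH; exact: redraw_memF rd fF.
  exists H' => //; apply: eqc => // v vC.
  by rewrite h1// mem_seq1.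
have [|H' [h1 h2]] := labelling_extend (alpha := alpha) (H := H) p1.
  by move=> f fF; rewrite -hF//; apply: lH; exact: redraw_memF (redraw_sym rd) fF.
by exists H' => //; symmetry; apply: eqc => // v _; rewrite h1.
Qed.

Definition neutral D S : Prop := forall e f, e \in S -> f \in edges D ->
  isect e f != 0 -> ~~ is_alpha alpha (deco D e f).

Lemma neutral_asum D S e t : neutral D S -> e \in S -> asum D e t = 0.
Proof. by move=> n eS; apply: alpha_sum_eq0 => f fD; exact: n. Qed.

Lemma neutral_asumF A s s' B F D D' f t : redraw A s s' B F D D' ->
  neutral D (chain A s B) -> f \in F -> asum D f t = alpha_sum alpha (deco D) F f t.
Proof.
move=> rd n fF; rewrite (redraw_asum _ _ rd) alpha_sum_eq0 ?add0r// => e eS n0.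
have fD := redraw_memF rd fF; have eD := redraw_memS rd eS.
rewrite isect_neqC in n0; rewrite (deco_flip_isect eD fD n0) is_alpha_flip.
exact: n.
Qed.

Lemma neutral_redraw A s s' B F D D' f t : redraw A s s' B F D D' ->
  neutral D (chain A s B) -> neutral D' (chain A s' B) -> f \in F ->
  asum D' f t = asum D f t.
Proof.
move=> rd n n' fF; rewrite (neutral_asumF _ rd n fF) -(redraw_asumF _ rd fF).
exact: neutral_asumF (redraw_sym rd) n' fF.
Qed.

Lemma chain_const A s B H : (forall e, e \in chain A s B -> H e.2 = H e.1) ->
  H B = H A /\ forall e, e \in chain A s B -> H e.1 = H A.
Proof.
elim: s A => [|C s IH] A h.
  split; first by rewrite (h (A, B)) ?inE.
  by move=> e; rewrite chain_nil inE => /eqP ->.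
have [|h1 h2] := IH C; first by move=> e eC; apply: h; rewrite chain_cons inE eC orbT.
have AC : H C = H A by rewrite (h (A, C)) ?inE ?eqxx.
split; first by rewrite h1.
by move=> e; rewrite chain_cons inE => /orP[/eqP -> //|/h2 ->].
Qed.

Lemma neutral_const A s s' B F D D' H : redraw A s s' B F D D' ->
  neutral D (chain A s B) -> lab D H ->
  H B = H A /\ forall e t, e \in chain A s B -> height alpha D H e t = H A.
Proof.
move=> rd n lH; have [|h1 h2] := @chain_const A s B H.
  move=> e eS; rewrite lH; last exact: redraw_memS rd eS.
  by rewrite (neutral_asum _ n eS) addr0.
by split=> // e t eS; rewrite /height (neutral_asum _ n eS) addr0 h2.
Qed.

Lemma strand_cross_weight k D c A s B H S : strand_virtual c A s B D ->
  {subset S <= edges D} ->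
  \sum_(e <- chain A s B) \sum_(f <- S) cw k D H e f = 0.
Proof.
move=> sv sub; rewrite big1_seq// => e /andP[_ eS]; rewrite big1_seq// => f /andP[_ fS].
rewrite /cross_weight; have [->|/isect_crosses h] := eqVneq (isect e f) 0.
  by rewrite weight0.
by rewrite sv ?weight_virtual//; exact: sub.
Qed.

(** A strand with virtual crossings of another type changes no label and carries no weight, before
    or after the move. *)
Lemma detour_other_transfers c A s s' B F D D' : c <> alpha ->
  redraw A s s' B F D D' -> strand_virtual c A s B D -> strand_virtual c A s' B D' ->
  transfers D D'.
Proof.
move=> ca rd sv sv'; have [p1 p2 _] := rd.
have n0 : ~~ is_alpha alpha (Virtual c) by apply/asboolP => -[].
have n : neutral D (chain A s B).
  by move=> e f eS fD /isect_crosses h; rewrite sv.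
have n' : neutral D' (chain A s' B).
  by move=> e f eS fD /isect_crosses h; rewrite sv'.
move=> k H k0 lH; have eqF f t fF := @neutral_redraw A s s' B F D D' f t rd n n' fF.
have [|H' [h1 h2]] := labelling_extend (alpha := alpha) (H := H) p2.
  by move=> f fF; rewrite eqF//; apply: lH; exact: redraw_memF rd fF.
exists H' => //.
rewrite (index_count_split _ _ _ p1) (index_count_split _ _ _ p2).
have [sS sF sS' sF'] := redraw_sub rd.
rewrite (strand_cross_weight _ _ sv sS) (strand_cross_weight _ _ sv sF).
rewrite (strand_cross_weight _ _ sv' sS') (strand_cross_weight _ _ sv' sF').
congr (_ + _); apply: eq_big_seq => e eF; apply: eq_big_seq => f fF.
apply: (redraw_cross_weight _ rd) => // _; rewrite /height !eqF//.
have [_ _ e1 _] := redraw_endsF rd eF; have [_ _ f1 _] := redraw_endsF rd fF.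
by rewrite !h1.
Qed.

End Transfer.

(** * Reidemeister moves *)

Section Reidemeister.
Variables (R : realType) (T : Type) (alpha : T).
Implicit Types (A B C v x y : pt R) (e f g : edge R) (F S : seq (edge R)) (t : R).
Implicit Types (D : diagram R T) (H : pt R -> int).

Local Notation asum D := (alpha_sum alpha (deco D) (edges D)).
Local Notation lab := (labelling alpha).
Local Notation cw := (cross_weight alpha).

Lemma classical_not_alpha (c : decoration T) : classical_deco c -> ~~ is_alpha alpha c.
Proof. by case=> ->; apply/asboolP. Qed.

Lemma in_triangle1 A B C : in_triangle A A B C.
Proof.
by exists 1, 0, 0; split; rewrite ?lexx ?ler01 ?addr0 ?add0r //; case: A => ? ? /=; congr pair; ring.
Qed.

Lemma in_triangle2 A B C : in_triangle B A B C.
Proof.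
by exists 0, 1, 0; split; rewrite ?lexx ?ler01 ?addr0 ?add0r //; case: B => ? ? /=; congr pair; ring.
Qed.

Lemma in_triangle3 A B C : in_triangle C A B C.
Proof.
by exists 0, 0, 1; split; rewrite ?lexx ?ler01 ?addr0 ?add0r //; case: C => ? ? /=; congr pair; ring.
Qed.

Lemma in_triangle_seg A B C x y t : in_triangle x A B C -> in_triangle y A B C ->
  0 <= t <= 1 -> in_triangle (pt_on (x, y) t) A B C.
Proof.
move=> [a [b [c [a0 b0 c0 abc ->]]]] [a' [b' [c' [a0' b0' c0' abc' ->]]]].
move=> /andP[t0 t1]; have u0 : 0 <= 1 - t by lra.
exists ((1 - t) * a + t * a'), ((1 - t) * b + t * b'), ((1 - t) * c + t * c').
split; try by apply: addr_ge0; exact: mulr_ge0.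
  transitivity ((1 - t) * (a + b + c) + t * (a' + b' + c')); first by ring.
  by rewrite abc abc'; ring.
by rewrite /pt_on /=; congr pair; ring.
Qed.

Lemma pt_on_between e t t1 t2 : t1 <= t <= t2 -> t1 < t2 ->
  exists2 u, 0 <= u <= 1 & pt_on e t = pt_on (pt_on e t1, pt_on e t2) u.
Proof.
move=> h lt; have d0 : 0 < t2 - t1 by lra.
exists ((t - t1) / (t2 - t1)).
  by rewrite ler_pdivlMr// ler_pdivrMr//; lra.
rewrite pt_on_pt_on; congr pt_on; field; exact: lt0r_neq0.
Qed.

Lemma pt_on_neq_vertex D e g t : e \in edges D -> g \in edges D -> 0 < t < 1 ->
  pt_on e t <> g.1 /\ pt_on e t <> g.2.
Proof.
move=> eD gD t01; have gen := edges_generic D; have cl := edges_closed D.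
have [n1 n2] := pt_on_neq_ends gen eD t01.
have on : on_seg (pt_on e t) e by exists t => //; lra.
split=> E; rewrite E in on n1 n2.
  by case: (on_seg_source gen eD gD on).
by case: (on_seg_target cl gen eD gD on).
Qed.

Definition is_vertex D v := exists2 g, g \in edges D & v = g.1 \/ v = g.2.

(** The points [A] and [B], exempted in [avoids_triangle], are vertices, and by general position a
    crossing is never a vertex. *)
Lemma avoids_triangle_crossing D A B C e g :
  is_vertex D A -> is_vertex D B -> e \in edges D -> isect e g != 0 ->
  avoids_triangle A B C g -> ~ in_triangle (pt_on e (cparam e g)) A B C.
Proof.
move=> [a aD vA] [b bD vB] eD n0 av tri; have t01 := cparam_itv n0.
have on : on_seg (pt_on e (cparam e g)) g.
  rewrite (pt_on_cparam n0); exists (cparam g e) => //.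
  by have := cparam_itv (_ : isect g e != 0); rewrite isect_neqC => /(_ n0); lra.
have [na1 na2] := pt_on_neq_vertex eD aD t01.
have [nb1 nb2] := pt_on_neq_vertex eD bD t01.
by case: (av _ on tri) => E; [case: vA => E' | case: vB => E']; rewrite E E' in na1 na2 nb1 nb2.
Qed.

Lemma avoids_triangle_side D A B C P Q g :
  is_vertex D A -> is_vertex D B -> (P, Q) \in edges D ->
  in_triangle P A B C -> in_triangle Q A B C ->
  avoids_triangle A B C g -> isect (P, Q) g = 0.
Proof.
move=> vA vB eD tP tQ av; apply/eqP/negPn/negP => n0.
apply: (avoids_triangle_crossing vA vB eD n0 av).
by apply: in_triangle_seg => //; have := cparam_itv n0; lra.
Qed.

(** By convexity the piece of [f] between the two points stays in the triangle, where no edge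
    forming an [alpha]-crossing with [f] can meet it. *)
Lemma alpha_sum_in_triangle D A B C f t1 t2 :
  is_vertex D A -> is_vertex D B -> f \in edges D ->
  in_triangle (pt_on f t1) A B C -> in_triangle (pt_on f t2) A B C ->
  (forall g, g \in edges D -> isect f g != 0 -> is_alpha alpha (deco D f g) ->
     avoids_triangle A B C g) ->
  asum D f t1 = asum D f t2.
Proof.
move=> vA vB fD; wlog t12 : t1 t2 / t1 < t2.
  move=> h h1 h2 av; case: (ltgtP t1 t2) => [lt|lt|->//]; first exact: h.
  by symmetry; exact: h.
move=> h1 h2 av; apply: eq_alpha_sum => g gD n0.
case al : (is_alpha _ _) => //=; apply/idP/idP => [lt|lt]; first by apply: lt_trans t12.
rewrite ltNge; apply/negP => le1.
apply: (avoids_triangle_crossing vA vB fD n0 (av g gD n0 al)).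
have [|u u01 ->] := @pt_on_between f (cparam f g) t1 t2 _ t12; first by rewrite le1 ltW.
exact: in_triangle_seg.
Qed.

(* As the sides of the triangle carry no alpha-crossing, all of them have the *)
(* height [H A]. *)
Lemma triangle_transfers A B C F D D' : redraw A [::] [:: C] B F D D' ->
  (forall f, f \in F -> isect (A, B) f != 0 -> ~~ is_alpha alpha (deco D (A, B) f)) ->
  (forall f, f \in F -> isect (A, C) f != 0 -> ~~ is_alpha alpha (deco D' (A, C) f)) ->
  (forall f, f \in F -> isect (C, B) f != 0 -> ~~ is_alpha alpha (deco D' (C, B) f)) ->
  (forall k H H', k != 0 -> H' A = H A -> H' B = H A -> (forall v, v != C -> H' v = H v) ->
    (forall f t, f \in F -> asum D' f t = asum D f t) ->
    forall f, f \in F ->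
    weight k (deco D (A, B) f) (isect (A, B) f)
      (H A - height alpha D H f (cparam f (A, B))) =
    weight k (deco D' (A, C) f) (isect (A, C) f)
      (H A - height alpha D' H' f (cparam f (A, C))) +
    weight k (deco D' (C, B) f) (isect (C, B) f)
      (H A - height alpha D' H' f (cparam f (C, B)))) ->
  transfers alpha D D' /\ transfers alpha D' D.
Proof.
move=> rd hAB hAC hCB hw; have [p1 p2 _] := rd.
have n : neutral alpha D (chain A [::] B).
  move=> e f; rewrite chain_nil inE => /eqP ->.
  rewrite (perm_mem p1) mem_cat chain_nil inE => /orP[/eqP ->|]; last exact: hAB.
  by rewrite isectxx.
have n' : neutral alpha D' (chain A [:: C] B).
  move=> e f; rewrite chain_cons chain_nil !inE => eS.
  rewrite (perm_mem p2) mem_cat chain_cons chain_nil !inE.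
  case/orP: eS => /eqP ->; case/orP => [/orP[] /eqP ->|fF].
  - by rewrite isectxx.
  - by rewrite isect_adjacent.
  - exact: hAC.
  - by rewrite isectC isect_adjacent.
  - by rewrite isectxx.
  - exact: hCB.
have eqF f t fF := @neutral_redraw _ _ alpha A [::] [:: C] B F D D' f t rd n n' fF.
apply: (insert_transfers rd) => [f fF t|k H H' k0 lH lH' HH f fF]; first exact: eqF.
have [HB hh] := neutral_const rd n lH.
have [HB' hh'] := neutral_const (redraw_sym rd) n' lH'.
have AC : A != C.
  have := redraw_inner (edges_closed D') p2 (v := C).
  by rewrite mem_seq1 eqxx eq_sym => /(_ isT)[].
have AA : H' A = H A by exact: HH.
rewrite /cross_weight (hh (A, B)) ?inE//.
rewrite (hh' (A, C)) ?(hh' (C, B)) ?chain_cons ?chain_nil ?inE ?eqxx ?orbT// AA.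
by apply: hw => //; rewrite HB' AA.
Qed.

End Reidemeister.

Section ReidemeisterMoves.
Variables (R : realType) (T : Type) (alpha : T).
Implicit Types (A B C v x y : pt R) (e f g : edge R) (F S : seq (edge R)) (t : R).
Implicit Types (D : diagram R T) (H : pt R -> int).

Local Notation asum D := (alpha_sum alpha (deco D) (edges D)).

Lemma crossing_isect D e f : e \in edges D -> f \in edges D ->
  crosses e f -> isect e f != 0.
Proof. exact: (crosses_isect (edges_closed D) (edges_generic D)). Qed.

Lemma weight_opp k (c : decoration T) i h : weight k c (- i) h = - weight k c i h.
Proof. by rewrite /weight mulrN mulNr. Qed.

Lemma insert_edges A B C F D D' : redraw A [::] [:: C] B F D D' ->
  [/\ (A, B) \in edges D, (A, C) \in edges D', (C, B) \in edges D',
      {subset F <= edges D} & {subset F <= edges D'}].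
Proof.
move=> rd; have [sS sF sS' sF'] := redraw_sub rd.
by split=> //; [apply: sS | apply: sS' | apply: sS'];
  rewrite ?chain_cons chain_nil !inE eqxx ?orbT.
Qed.

Lemma insert_edgesP A B C F D D' : redraw A [::] [:: C] B F D D' ->
  (forall g, g \in edges D -> g = (A, B) \/ g \in F) /\
  (forall g, g \in edges D' -> [\/ g = (A, C), g = (C, B) | g \in F]).
Proof.
case=> p1 p2 _; split=> g; rewrite ?(perm_mem p1) ?(perm_mem p2) mem_cat !inE.
  by case/orP=> [/eqP|]; [left | right].
by case/orP => [/orP[] /eqP|]; [exact: Or31 | exact: Or32 | exact: Or33].
Qed.

Lemma insert_vertices A B C F D D' : redraw A [::] [:: C] B F D D' ->
  [/\ is_vertex D A, is_vertex D B, is_vertex D' A & is_vertex D' B].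
Proof.
case/insert_edges => h1 h2 h3 _ _.
by split; [exists (A, B) | exists (A, B) | exists (A, C) | exists (C, B)] => //;
  [left | right | left | right].
Qed.

(** From [B] to the new crossing the edge [BE] runs inside the triangle and passes no
    [alpha]-crossing, so both strands of the kink have height [H A] and its index is 0. *)
Lemma reidemeister1_transfers D D' : reidemeister1 D D' ->
  transfers alpha D D' /\ transfers alpha D' D.
Proof.
case=> A [B [C [E [F [rd [BEF cr] av cl]]]]].
have [eAB eAC eCB sF sF'] := insert_edges rd.
have [vA vB vA' vB'] := insert_vertices rd.
have [edD edD'] := insert_edgesP rd.
have [t1 t2 t3] : [/\ in_triangle A A B C, in_triangle B A B C & in_triangle C A B C].
  by split; [exact: in_triangle1 | exact: in_triangle2 | exact: in_triangle3].
have nBE A' : isect (A', B) (B, E) = 0 by exact: isect_adjacent.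
have zAB f : f \in F -> isect (A, B) f = 0.
  move=> fF; have [-> //|/eqP ne] := eqVneq f (B, E).
  exact: avoids_triangle_side vA vB eAB t1 t2 (av _ fF ne).
have zCB f : f \in F -> isect (C, B) f = 0.
  move=> fF; have [-> //|/eqP ne] := eqVneq f (B, E).
  exact: avoids_triangle_side vA' vB' eCB t3 t2 (av _ fF ne).
have zAC f : f \in F -> f <> (B, E) -> isect (A, C) f = 0.
  by move=> fF ne; exact: avoids_triangle_side vA' vB' eAC t1 t3 (av _ fF ne).
apply: (triangle_transfers rd) => [f fF|f fF|f fF|].
- by rewrite zAB.
- by have [-> _|/eqP ne] := eqVneq f (B, E); [exact: classical_not_alpha | rewrite zAC].
- by rewrite zCB.
move=> k H H' k0 HA HB HH hF f fF; rewrite zAB// zCB// !weight0 addr0.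
have [-> |/eqP ne] := eqVneq f (B, E); last by rewrite zAC// weight0.
have n0 : isect (A, C) (B, E) != 0.
  exact: (crossing_isect eAC (sF' _ BEF)).
have n0' : isect (B, E) (A, C) != 0 by rewrite isect_neqC.
rewrite /height /= HB.
rewrite -(@alpha_sum_in_triangle _ _ alpha D' A B C (B, E) 0) ?sF'//.
- by rewrite alpha_sum0 addr0 subrr weight_index0.
- by rewrite pt_on0.
- rewrite (pt_on_cparam n0'); apply: in_triangle_seg => //.
  exact: cparam_itvW n0.
move=> g /edD'[-> _ |->|gF].
- rewrite (deco_flip_isect eAC (sF' _ BEF) n0) is_alpha_flip.
  by rewrite (negbTE (classical_not_alpha alpha cl)).
- by rewrite isectC nBE.
have [-> |/eqP ne _ _] := eqVneq g (B, E); first by rewrite isectxx.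
exact: av.
Qed.

Lemma isect_neq_sides e f : isect e f != 0 ->
  (orient f.1 f.2 e.2 < 0 /\ 0 < orient f.1 f.2 e.1) \/
  (orient f.1 f.2 e.1 < 0 /\ 0 < orient f.1 f.2 e.2).
Proof. by case: isectP => // *; [left | right]. Qed.

Lemma isect_same_side e f : 0 < orient f.1 f.2 e.1 * orient f.1 f.2 e.2 ->
  isect e f = 0.
Proof.
move=> h; apply/eqP/negPn/negP => /isect_neq_sides[] [h1 h2]; move: h.
  by rewrite pmulr_rgt0// (lt_gtF h1).
by rewrite nmulr_rgt0// (lt_gtF h2).
Qed.

Lemma opposite_twice (u v w : R) : v < 0 /\ 0 < u \/ u < 0 /\ 0 < v ->
  w < 0 /\ 0 < v \/ v < 0 /\ 0 < w -> 0 < u * w.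
Proof.
case=> -[h1 h2] [] [h3 h4]; try by move: (lt_trans h1 h4) (lt_trans h3 h2); rewrite ltxx.
- exact: mulr_gt0.
- by rewrite nmulr_rgt0.
Qed.

Lemma pmul_gt0_eq (u w : R) : 0 < u * w -> (0 < u) = (0 < w).
Proof.
case: (ltgtP u 0) => [h|h|->]; last by rewrite mul0r ltxx.
  by rewrite nmulr_rgt0// => /ltW; rewrite leNgt => /negbTE ->.
by rewrite pmulr_rgt0// => ->.
Qed.

Lemma isect_sign e f : isect e f != 0 ->
  isect e f = if 0 < orient f.1 f.2 e.1 then 1 else -1.
Proof.
by case: isectP => // _ _; [move=> _ -> | move=> h _; rewrite (lt_gtF h)].
Qed.

(** The edge [f] separates [C] from both [A] and [B]. It therefore misses [AB] and crosses [AC] and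
    [CB] with opposite signs; its height is the same at both crossings, and the weights cancel. *)
Lemma reidemeister2_transfers D D' : reidemeister2 D D' ->
  transfers alpha D D' /\ transfers alpha D' D.
Proof.
case=> A [B [C [f [F [rd [fF cAC cCB] av cl cl']]]]].
have [eAB eAC eCB sF sF'] := insert_edges rd.
have [vA vB vA' vB'] := insert_vertices rd.
have [edD edD'] := insert_edgesP rd.
have [t1 t2 t3] : [/\ in_triangle A A B C, in_triangle B A B C & in_triangle C A B C].
  by split; [exact: in_triangle1 | exact: in_triangle2 | exact: in_triangle3].
have n1 : isect (A, C) f != 0.
  exact: (crossing_isect eAC (sF' _ fF)).
have n2 : isect (C, B) f != 0.
  exact: (crossing_isect eCB (sF' _ fF)).
have n1' : isect f (A, C) != 0 by rewrite isect_neqC.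
have n2' : isect f (C, B) != 0 by rewrite isect_neqC.
have opp : isect (C, B) f = - isect (A, C) f.
  rewrite (isect_sign n1) (isect_sign n2) /=.
  by case: (isect_neq_sides n1) => /= -[h1 h2];
    rewrite ?h1 ?h2 ?(lt_gtF h1) ?(lt_gtF h2).
have zABf : isect (A, B) f = 0.
  apply: isect_same_side.
  exact: opposite_twice (isect_neq_sides n1) (isect_neq_sides n2).
have zAB g : g \in F -> isect (A, B) g = 0.
  move=> gF; have [-> //|/eqP ne] := eqVneq g f.
  exact: avoids_triangle_side vA vB eAB t1 t2 (av _ gF ne).
have zAC g : g \in F -> g <> f -> isect (A, C) g = 0.
  by move=> gF ne; exact: avoids_triangle_side vA' vB' eAC t1 t3 (av _ gF ne).
have zCB g : g \in F -> g <> f -> isect (C, B) g = 0.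
  by move=> gF ne; exact: avoids_triangle_side vA' vB' eCB t3 t2 (av _ gF ne).
apply: (triangle_transfers rd) => [g gF|g gF|g gF|].
- by rewrite zAB.
- by have [-> _|/eqP ne] := eqVneq g f; [exact: classical_not_alpha | rewrite zAC].
- have [-> _|/eqP ne] := eqVneq g f; last by rewrite zCB.
  by rewrite cl'; exact: classical_not_alpha.
move=> k H H' k0 HA HB HH hF g gF; rewrite zAB// weight0.
have [-> |/eqP ne] := eqVneq g f; last by rewrite zAC// zCB// !weight0 addr0.
rewrite cl' opp weight_opp /height.
rewrite -(@alpha_sum_in_triangle _ _ alpha D' A B C f (cparam f (A, C))) ?subrr ?sF'//.
- rewrite (pt_on_cparam n1'); apply: in_triangle_seg => //.
  exact: cparam_itvW n1.
- rewrite (pt_on_cparam n2'); apply: in_triangle_seg => //.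
  exact: cparam_itvW n2.
have na := negbTE (classical_not_alpha alpha cl).
move=> h /edD'[-> _ |-> _|hF'].
- by rewrite (deco_flip_isect eAC (sF' _ fF) n1) is_alpha_flip na.
- by rewrite (deco_flip_isect eCB (sF' _ fF) n2) is_alpha_flip cl' na.
have [-> |/eqP ne _ _] := eqVneq h f; first by rewrite isectxx.
exact: av.
Qed.

(** The crossings of [AB] with [f] and [g] pass to [AC] and [CB] with the same signs, since [A] and
    [C] lie on the same side of [g], while [f] separates [A] from both [B] and [C]. Inside the
    triangle [f] and [g] meet no [alpha]-crossing, so their heights agree too. The crossing of [f]
    with [g] belongs to [F] and keeps its weight. *)
Lemma reidemeister3_transfers D D' : reidemeister3 D D' ->
  transfers alpha D D' /\ transfers alpha D' D.
Proof.
case=> A [B [C [f [g [F [rd [fF cABf cACf df] [gF cABg cCBg dg]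
  [[fg _] av] [cl1 cl2 cl3 _]]]]]]].
have [eAB eAC eCB sF sF'] := insert_edges rd.
have [vA vB vA' vB'] := insert_vertices rd.
have [edD edD'] := insert_edgesP rd.
have [t1 t2 t3] : [/\ in_triangle A A B C, in_triangle B A B C & in_triangle C A B C].
  by split; [exact: in_triangle1 | exact: in_triangle2 | exact: in_triangle3].
have nABf : isect (A, B) f != 0.
  exact: (crossing_isect eAB (sF _ fF)).
have nABg : isect (A, B) g != 0.
  exact: (crossing_isect eAB (sF _ gF)).
have nACf : isect (A, C) f != 0.
  exact: (crossing_isect eAC (sF' _ fF)).
have nCBg : isect (C, B) g != 0.
  exact: (crossing_isect eCB (sF' _ gF)).
have swap e h : isect e h != 0 -> isect h e != 0 by rewrite isect_neqC.
have sf : isect (A, C) f = isect (A, B) f.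
  by rewrite (isect_sign nACf) (isect_sign nABf).
have gAC : 0 < orient g.1 g.2 A * orient g.1 g.2 C.
  by apply: opposite_twice (isect_neq_sides nABg) _; exact/or_comm/(isect_neq_sides nCBg).
have zACg : isect (A, C) g = 0 by exact: isect_same_side.
have sg : isect (C, B) g = isect (A, B) g.
  by rewrite (isect_sign nCBg) (isect_sign nABg) /= (pmul_gt0_eq gAC).
have zCBf : isect (C, B) f = 0.
  apply: isect_same_side; apply: opposite_twice (isect_neq_sides nABf).
  exact/or_comm/(isect_neq_sides nACf).
have z h : h \in F -> h <> f -> h <> g ->
    [/\ isect (A, B) h = 0, isect (A, C) h = 0 & isect (C, B) h = 0].
  move=> hF hf hg; have a := av _ hF hf hg; split.
  - exact: avoids_triangle_side vA vB eAB t1 t2 a.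
  - exact: avoids_triangle_side vA' vB' eAC t1 t3 a.
  - exact: avoids_triangle_side vA' vB' eCB t3 t2 a.
have flipA e h : e \in edges D -> h \in edges D -> isect e h != 0 ->
    is_alpha alpha (deco D h e) = is_alpha alpha (deco D e h).
  by move=> eD hD n; rewrite (deco_flip_isect eD hD n) is_alpha_flip.
have clABg : ~~ is_alpha alpha (deco D (A, B) g).
  rewrite -(flipA (A, B) g eAB (sF _ gF) nABg); exact: classical_not_alpha.
have clABf : ~~ is_alpha alpha (deco D (A, B) f) by exact: classical_not_alpha.
have clfg : ~~ is_alpha alpha (deco D f g) by exact: classical_not_alpha.
have ptri e P Q : isect (P, Q) e != 0 -> in_triangle P A B C -> in_triangle Q A B C ->
    in_triangle (pt_on e (cparam e (P, Q))) A B C.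
  move=> n tP tQ; rewrite (pt_on_cparam (swap _ _ n)); apply: in_triangle_seg => //.
  exact: cparam_itvW n.
apply: (triangle_transfers rd) => [h hF|h hF|h hF|].
- have [->|/eqP hf] := eqVneq h f; first by [].
  by have [->|/eqP hg] := eqVneq h g; last by have [-> _ _] := z h hF hf hg.
- have [-> _|/eqP hf] := eqVneq h f; first by rewrite df.
  by have [->|/eqP hg] := eqVneq h g; [rewrite zACg | have [_ -> _] := z h hF hf hg].
- have [->|/eqP hf] := eqVneq h f; first by rewrite zCBf.
  by have [-> _|/eqP hg] := eqVneq h g; [rewrite dg | have [_ _ ->] := z h hF hf hg].
move=> k H H' k0 HA HB HH hF h hF'.
have Hh e : e \in F -> H' e.1 = H e.1.
  by move=> eF; apply: HH; have [_ _ +  _] := redraw_endsF rd eF; rewrite mem_seq1.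
have [->|/eqP hf] := eqVneq h f.
  rewrite zCBf weight0 addr0 df sf /height Hh// hF//.
  congr (weight _ _ _ (_ - (_ + _))); apply: (alpha_sum_in_triangle vA vB (sF _ fF)).
  - exact: ptri.
  - exact: ptri.
  move=> e /edD[->|eF] n; first by rewrite (flipA (A, B) f eAB (sF _ fF) nABf) (negbTE clABf).
  have [ef|/eqP ef] := eqVneq e f; first by rewrite ef isectxx in n.
  have [->|/eqP eg _] := eqVneq e g; first by rewrite (negbTE clfg).
  exact: av.
have [->|/eqP hg] := eqVneq h g; last first.
  by have [-> -> ->] := z h hF' hf hg; rewrite !weight0 addr0.
rewrite zACg weight0 add0r dg sg /height Hh// hF//.
congr (weight _ _ _ (_ - (_ + _))); apply: (alpha_sum_in_triangle vA vB (sF _ gF)).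
- exact: ptri.
- exact: ptri.
move=> e /edD[->|eF] n; first by rewrite (flipA (A, B) g eAB (sF _ gF) nABg) (negbTE clABg).
have [ef|/eqP ef] := eqVneq e g; first by rewrite ef isectxx in n.
have [E|/eqP eg _] := eqVneq e f; last exact: av.
by rewrite E in n *; rewrite (flipA f g) ?sF ?(negbTE clfg)// isect_neqC.
Qed.

End ReidemeisterMoves.

(** * Subdivision of an edge *)

Section Subdivision.
Variables (R : realType) (T : Type) (alpha : T).
Implicit Types (A B C : pt R) (e f g : edge R) (F : seq (edge R)) (t c : R).
Implicit Types (D : diagram R T) (H : pt R -> int).

Local Notation asum D := (alpha_sum alpha (deco D) (edges D)).

Lemma orient_scale A B X Y t : X.1 - Y.1 = t * (B.1 - A.1) ->
  X.2 - Y.2 = t * (B.2 - A.2) -> orient A B Y = 0 ->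
  forall Z, orient Y X Z = t * orient A B Z.
Proof.
move=> h1 h2 o Z; rewrite {1}/orient h1 h2.
have : orient A B Z - orient A B Y = (B.1 - A.1) * (Z.2 - Y.2) - (B.2 - A.2) * (Z.1 - Y.1).
  by rewrite /orient; ring.
by rewrite o subr0 => ->; ring.
Qed.

Variant subdivide_spec A B C f c : Prop :=
| SubdivideNone of isect (A, B) f = 0 & isect (A, C) f = 0 & isect (C, B) f = 0
| SubdivideLeft of isect (A, B) f != 0 & isect (A, C) f = isect (A, B) f &
    isect (C, B) f = 0 & cparam (A, B) f < c
| SubdivideRight of isect (A, B) f != 0 & isect (A, C) f = 0 &
    isect (C, B) f = isect (A, B) f & c < cparam (A, B) f.

Section Subdivide.
Variables (A B C : pt R) (c : R).
Hypotheses (c01 : 0 < c < 1) (Cc : C = pt_on (A, B) c).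

Let c0 : 0 < c. Proof. by case/andP: c01. Qed.
Let c1 : 0 < 1 - c. Proof. by rewrite subr_gt0; case/andP: c01. Qed.

Lemma orient_left X : orient A C X = c * orient A B X.
Proof.
rewrite Cc; apply: (@orient_scale A B); rewrite /pt_on /orient /=; ring.
Qed.

Lemma orient_right X : orient C B X = (1 - c) * orient A B X.
Proof.
rewrite Cc; apply: (@orient_scale A B); rewrite /pt_on /orient /=; ring.
Qed.

Lemma orient_mid f :
  orient f.1 f.2 C = (1 - c) * orient f.1 f.2 A + c * orient f.1 f.2 B.
Proof. by rewrite Cc orient_pt_on. Qed.

Lemma cparamr_left f : cparam f (A, C) = cparam f (A, B).
Proof.
rewrite /cparam /= !orient_left -mulrBr invfM mulrACA divff ?mul1r//.
exact: lt0r_neq0.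
Qed.

Lemma cparamr_right f : cparam f (C, B) = cparam f (A, B).
Proof.
rewrite /cparam /= !orient_right -mulrBr invfM mulrACA divff ?mul1r//.
exact: lt0r_neq0.
Qed.

Lemma cparaml_left f : cparam (A, C) f = cparam (A, B) f / c.
Proof.
rewrite /cparam /= orient_mid.
rewrite [X in _ / X](_ : _ = c * (orient f.1 f.2 A - orient f.1 f.2 B)); last by ring.
by rewrite invfM mulrA mulrAC.
Qed.

Lemma cparaml_right f : isect (A, B) f != 0 ->
  cparam (C, B) f = (cparam (A, B) f - c) / (1 - c).
Proof.
move=> /isect_orient_neq /= n0; have n1 := lt0r_neq0 c1.
rewrite /cparam /= orient_mid.
rewrite [X in _ / X](_ : _ = (1 - c) * (orient f.1 f.2 A - orient f.1 f.2 B)); last by ring.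
by field; rewrite n0 n1.
Qed.

Let sgl X : ((orient A C X < 0) = (orient A B X < 0)) * ((0 < orient A C X) = (0 < orient A B X)).
Proof. by rewrite orient_left pmulr_rlt0// pmulr_rgt0. Qed.

Let sgr X : ((orient C B X < 0) = (orient A B X < 0)) * ((0 < orient C B X) = (0 < orient A B X)).
Proof. by rewrite orient_right pmulr_rlt0// pmulr_rgt0. Qed.

Let below_sides f : orient f.1 f.2 C < 0 -> 0 < orient f.1 f.2 A -> orient f.1 f.2 B < 0.
Proof.
rewrite orient_mid => m a; rewrite -(pmulr_rlt0 _ c0).
by have := mulr_gt0 c1 a; lra.
Qed.

Let above_sides f : 0 < orient f.1 f.2 C -> orient f.1 f.2 A < 0 -> 0 < orient f.1 f.2 B.
Proof.
rewrite orient_mid => m a; rewrite -(pmulr_rgt0 _ c0).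
have : (1 - c) * orient f.1 f.2 A < 0 by rewrite pmulr_rlt0.
by lra.
Qed.

Let below_sides' f : orient f.1 f.2 C < 0 -> 0 < orient f.1 f.2 B -> orient f.1 f.2 A < 0.
Proof.
rewrite orient_mid => m b; rewrite -(pmulr_rlt0 _ c1).
by have := mulr_gt0 c0 b; lra.
Qed.

Let above_sides' f : 0 < orient f.1 f.2 C -> orient f.1 f.2 B < 0 -> 0 < orient f.1 f.2 A.
Proof.
rewrite orient_mid => m b; rewrite -(pmulr_rgt0 _ c1).
have : c * orient f.1 f.2 B < 0 by rewrite pmulr_rlt0.
by lra.
Qed.

Lemma isect_left f : isect (A, C) f != 0 ->
  isect (A, B) f = isect (A, C) f /\ isect (C, B) f = 0.
Proof.
case: isectP => //=; rewrite !sgl => p q m a _.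
  have b := below_sides m a; split; first exact: isect_eq1.
  by apply: isect_same_side; rewrite /= nmulr_rgt0.
have b := above_sides a m; split; first exact: isect_eqN1.
by apply: isect_same_side; rewrite /= mulr_gt0.
Qed.

Lemma isect_right f : isect (C, B) f != 0 ->
  isect (A, B) f = isect (C, B) f /\ isect (A, C) f = 0.
Proof.
case: isectP => //=; rewrite !sgr => p q m a _.
  have b := above_sides' a m; split; first exact: isect_eq1.
  by apply: isect_same_side; rewrite /= mulr_gt0.
have b := below_sides' m a; split; first exact: isect_eqN1.
by apply: isect_same_side; rewrite /= nmulr_rgt0.
Qed.

(** As [f] misses [C], a crossing of [f] with [AB] falls strictly before or strictly after [C], and
    the other half is not crossed. *)
Lemma subdivideP f : ~ on_seg C f -> subdivide_spec A B C f c.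
Proof.
move=> off.
have m0 : isect (A, B) f != 0 -> orient f.1 f.2 C != 0.
  move=> n0; apply/eqP => m0; apply: off.
  have n1 := isect_orient_neq n0; have E : cparam (A, B) f = c.
    rewrite /cparam /=; apply: (mulIf n1); rewrite divfK//=.
    by move: m0; rewrite orient_mid; lra.
  rewrite Cc -E (pt_on_cparam n0); exists (cparam f (A, B)) => //.
  by apply: cparam_itvW; rewrite isect_neqC.
have [l0|l] := eqVneq (isect (A, C) f) 0; last first.
  have [E1 E2] := isect_left l; apply: SubdivideLeft => //; first by rewrite E1.
  have := cparam_itv l; rewrite cparaml_left => /andP[_].
  by rewrite ltr_pdivrMr// mul1r.
have [r0|r] := eqVneq (isect (C, B) f) 0; last first.
  have [E1 E2] := isect_right r; have n0 : isect (A, B) f != 0 by rewrite E1.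
  apply: SubdivideRight => //.
  have := cparam_itv r; rewrite cparaml_right// => /andP[+ _].
  by rewrite pmulr_lgt0 ?invr_gt0// subr_gt0.
apply: SubdivideNone => //; apply/eqP/negPn/negP => n0; have := m0 n0.
rewrite neq_lt => /orP[] m; case: (isectP (A, B) f) n0 => //= p q b a _.
- suff : isect (A, C) f = 1 by rewrite l0.
  by apply: isect_eq1; rewrite /= ?sgl.
- suff : isect (C, B) f = -1 by rewrite r0.
  by apply: isect_eqN1; rewrite /= ?sgr.
- suff : isect (C, B) f = 1 by rewrite r0.
  by apply: isect_eq1; rewrite /= ?sgr.
- suff : isect (A, C) f = -1 by rewrite l0.
  by apply: isect_eqN1; rewrite /= ?sgl.
Qed.

End Subdivide.

(** On each half the parameter is rescaled increasingly, so the order of crossings is kept. The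
    label of [C] is the height of [AB] at [C], so the heights agree beyond [C] as well. *)
Lemma subdivision_transfers D D' : subdivision D D' ->
  transfers alpha D D' /\ transfers alpha D' D.
Proof.
case=> A [B [C [F [rd [c c01 Cc] dAC dCB]]]].
have [eAB eAC eCB sF sF'] := insert_edges rd.
have [p1 p2 _] := rd.
have offF f : f \in F -> ~ on_seg C f.
  move=> fF on; have [C1 C2] : C <> f.1 /\ C <> f.2.
    have [_ _ nC1 nC2] := redraw_endsF rd fF.
    by split=> E; [move: nC1 | move: nC2]; rewrite -E mem_seq1 eqxx.
  by case: (on_seg_source (edges_generic D') (sF' _ fF) eCB on).
have spec f fF := subdivideP c01 Cc (offF f fF).
have aAC f : f \in F -> isect (A, C) f != 0 -> deco D' (A, C) f = deco D (A, B) f.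
  by move=> fF /isect_crosses; exact: dAC.
have aCB f : f \in F -> isect (C, B) f != 0 -> deco D' (C, B) f = deco D (A, B) f.
  by move=> fF /isect_crosses; exact: dCB.
have flipA D0 e h : e \in edges D0 -> h \in edges D0 -> isect e h != 0 ->
    is_alpha alpha (deco D0 h e) = is_alpha alpha (deco D0 e h).
  by move=> eD hD n; rewrite (deco_flip_isect eD hD n) is_alpha_flip.
have hF f t : f \in F -> asum D' f t = asum D f t.
  move=> fF; rewrite (redraw_asum _ _ _ rd) (redraw_asum _ _ _ (redraw_sym rd)).
  rewrite (redraw_asumF _ _ rd fF); congr (_ + _).
  rewrite chain_cons !chain_nil !alpha_sum_cons !alpha_sum_nil !addr0.
  rewrite (cparamr_left c01 Cc) (cparamr_right c01 Cc).
  rewrite (isectC (A, C)) (isectC (C, B)) (isectC (A, B)).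
  case: (spec f fF) => [-> -> ->|n0 E1 E2 _|n0 E2 E1 _].
  - by rewrite !oppr0 !if_same.
  - have n1 : isect (A, C) f != 0 by rewrite E1.
    rewrite E1 E2 oppr0 if_same addr0 (flipA D (A, B) f eAB (sF _ fF) n0).
    by rewrite (flipA D' (A, C) f eAC (sF' _ fF) n1) aAC.
  - have n1 : isect (C, B) f != 0 by rewrite E1.
    rewrite E1 E2 oppr0 if_same add0r (flipA D (A, B) f eAB (sF _ fF) n0).
    by rewrite (flipA D' (C, B) f eCB (sF' _ fF) n1) aCB.
apply: (insert_transfers rd) => [f fF t|k H H' k0 lH lH' HH f fF]; first exact: hF.
have sAB t : asum D (A, B) t = alpha_sum alpha (deco D) F (A, B) t.
  rewrite (redraw_asum _ _ _ rd) chain_nil alpha_sum_cons alpha_sum_nil isectxx.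
  by rewrite if_same !add0r.
have sAC t : asum D' (A, C) t = alpha_sum alpha (deco D') F (A, C) t.
  rewrite (redraw_asum _ _ _ (redraw_sym rd)) chain_cons chain_nil !alpha_sum_cons.
  by rewrite alpha_sum_nil isectxx isect_adjacent !if_same !add0r.
have sCB t : asum D' (C, B) t = alpha_sum alpha (deco D') F (C, B) t.
  rewrite (redraw_asum _ _ _ (redraw_sym rd)) chain_cons chain_nil !alpha_sum_cons.
  by rewrite alpha_sum_nil isectxx isectC isect_adjacent oppr0 !if_same !add0r.
have AC : A != C.
  have := redraw_inner (edges_closed D') p2 (v := C).
  by rewrite mem_seq1 eqxx eq_sym => /(_ isT)[].
have Hf : height alpha D' H' f (cparam f (A, B)) = height alpha D H f (cparam f (A, B)).
  rewrite /height hF// HH//.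
  by have [_ _ + _] := redraw_endsF rd fF; rewrite mem_seq1.
have [c0 c1] : 0 < c /\ 0 < 1 - c by lra.
rewrite /cross_weight (cparamr_left c01 Cc) (cparamr_right c01 Cc).
case: (spec f fF) => [-> -> ->|n0 E1 E2 lt|n0 E2 E1 lt]; rewrite ?E1 ?E2 !weight0 ?addr0 ?add0r //.
- rewrite aAC ?E1//; congr (weight _ _ _ (_ - _)); last by rewrite Hf.
  rewrite /height /= HH// sAB sAC; congr (_ + _).
  rewrite /alpha_sum big_mkcond [RHS]big_mkcond /=; apply: eq_big_seq => g gF.
  rewrite !(cparaml_left Cc) ltr_pM2r ?invr_gt0//.
  case: (spec g gF) => [-> -> _|m0 F1 F2 lt'|m0 -> F2 lt'].
  - by rewrite !if_same.
  - by rewrite F1 aAC// F1.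
  - by rewrite if_same (lt_gtF (lt_trans lt lt')) andbF.
- rewrite aCB ?E1//; congr (weight _ _ _ (_ - _)); last by rewrite Hf.
  rewrite /height /= (lH' _ eAC) /= HH// sAB sAC sCB -addrA; congr (_ + _).
  rewrite /alpha_sum big_mkcond [X in _ = X + _]big_mkcond [X in _ = _ + X]big_mkcond /=.
  rewrite -big_split /=; apply: eq_big_seq => g gF.
  case: (spec g gF) => [-> -> ->|m0 F1 -> lt'|m0 -> F2 lt'].
  - by rewrite !if_same.
  - have n1 : isect (A, C) g != 0 by rewrite F1.
    rewrite if_same addr0 F1 aAC// (lt_trans lt' lt).
    by have /andP[_ ->] := cparam_itv n1.
  - rewrite if_same add0r F2 aCB ?F2// !(cparaml_right c01 Cc)//.
    by rewrite ltr_pM2r ?invr_gt0// ltrD2r.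
Qed.

End Subdivision.

(** * Detours and winding numbers *)

Section AlphaDetour.
Variables (R : realType) (T : Type) (alpha : T).
Implicit Types (A B C v : pt R) (e f g : edge R) (F S : seq (edge R)) (t : R).
Implicit Types (s : seq (pt R)).
Implicit Types (D : diagram R T) (H : pt R -> int).

Local Notation asum D := (alpha_sum alpha (deco D) (edges D)).

Definition crossing_sum S f t : int :=
  \sum_(e <- S) if cparam f e < t then isect f e else 0.

(** For a closed polygon [S] missing [v] this is the clockwise winding number of [S] about [v]. *)
Definition ray_sum S v : int := \sum_(e <- S) ray_above v e.

Definition off_strand S v : Prop := forall e, e \in S -> ~ on_seg v e.

Lemma isect_degenerate v e : isect (v, v) e = 0.
Proof.
have o c : orient v v c = 0 by rewrite /orient; ring.
by case: isectP => //=; rewrite o ltxx.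
Qed.

Lemma isect_initial f e t : 0 <= t <= 1 -> ~ on_seg (pt_on f t) e ->
  isect (f.1, pt_on f t) e = if cparam f e < t then isect f e else 0.
Proof.
move=> /andP[]; rewrite le_eqVlt => /predU1P[<- _ _|t0].
  by rewrite pt_on0 isect_degenerate; case: ifP => // h; apply/esym/eqP/negPn/negP => /cparam_itv/andP[/(lt_trans h)]; rewrite ltxx.
rewrite le_eqVlt => /predU1P[-> _|t1].
  rewrite pt_on1 -surjective_pairing.
  by case: ifP => // /negP h; apply/eqP/negPn/negP => /cparam_itv/andP[_ /h].
have t01 : 0 < t < 1 by rewrite t0.
case: f => P Q off; case: (subdivideP t01 (erefl _) off) => [-> -> _|_ -> _ ->//|_ -> _ h]; first by rewrite if_same.
by rewrite (lt_gtF h).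
Qed.

Lemma isect_between f e t1 t2 : 0 <= t1 -> t1 < t2 -> t2 <= 1 ->
  ~ on_seg (pt_on f t1) e -> ~ on_seg (pt_on f t2) e ->
  isect (pt_on f t1, pt_on f t2) e =
  (if cparam f e < t2 then isect f e else 0) - (if cparam f e < t1 then isect f e else 0).
Proof.
move=> t10 t12 t21 off1 off2; rewrite -!isect_initial//; try by lra.
move: t10; rewrite le_eqVlt => /predU1P[E|t1_gt0].
  by rewrite -E pt_on0 isect_degenerate subr0.
have t2_gt0 : 0 < t2 by exact: lt_trans t12.
have u01 : 0 < t1 / t2 < 1 by rewrite divr_gt0// ltr_pdivrMr// mul1r.
have E : pt_on f t1 = pt_on (f.1, pt_on f t2) (t1 / t2).
  rewrite -[in RHS](pt_on0 f) pt_on_pt_on mulr0 add0r divfK//; exact: lt0r_neq0.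
by case: (subdivideP u01 E off1) => [-> -> ->|_ -> -> _|_ -> -> _]; rewrite ?subrr ?subr0.
Qed.

Lemma chain_sum A s B (h : pt R -> int) :
  \sum_(e <- chain A s B) (h e.2 - h e.1) = h B - h A.
Proof.
elim: s A => [|C s IH] A; first by rewrite chain_nil big_seq1.
by rewrite chain_cons big_cons IH /= addrC addrA subrK.
Qed.

(* The crossings of [f] with the closed curve formed by two strands from [A]  *)
(* to [B] are counted by the winding number: the correction terms at [A] and  *)
(* [B] do not depend on the strand. *)
Lemma chain_ray D A s B f t1 t2 : {subset chain A s B <= edges D} -> f \in edges D ->
  0 <= t1 -> t1 < t2 -> t2 <= 1 ->
  off_strand (chain A s B) (pt_on f t1) -> off_strand (chain A s B) (pt_on f t2) ->
  crossing_sum (chain A s B) f t2 - crossing_sum (chain A s B) f t1 =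
  ray_sum (chain A s B) (pt_on f t2) - ray_sum (chain A s B) (pt_on f t1) +
  (ray_below B (pt_on f t1, pt_on f t2) - ray_below A (pt_on f t1, pt_on f t2)).
Proof.
move=> sub fD t10 t12 t21 off1 off2.
rewrite -(chain_sum A s B (fun P => ray_below P (pt_on f t1, pt_on f t2))) -!sumrB -big_split /=; apply: eq_big_seq => e eS.
have eD := sub e eS; rewrite -isect_between//; [|exact: off1|exact: off2].
have on1 : on_seg e.1 e by exists 0; [lra | rewrite pt_on0].
have on2 : on_seg e.2 e by exists 1; [lra | rewrite pt_on1].
(* General position keeps the ends of [e] away from the interior of [f]. What remains is
   [w = t1 = 0] or [w = t2 = 1], where the point is off the strand by hypothesis. *)
have avoid v : v = e.1 \/ v = e.2 -> ~ on_seg v (pt_on f t1, pt_on f t2).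
  move=> ve [u /andP[u0 u1]]; rewrite pt_on_pt_on; set w := _ + _ => vw.
  have on : on_seg v e by case: ve => ->.
  have d0 : 0 < t2 - t1 by lra.
  have m1 : 0 <= u * (t2 - t1) by apply: mulr_ge0 => //; exact: ltW.
  have m2 : 0 <= (1 - u) * (t2 - t1) by apply: mulr_ge0; [lra | exact: ltW].
  have wl : t1 <= w by rewrite /w; lra.
  have wr : w <= t2 by rewrite /w; lra.
  have [w0|w0] := leP w 0.
    have E : w = t1 by lra.
    by apply: (off1 e eS); rewrite -E -vw.
  have [w1|w1] := leP 1 w.
    have E : w = t2 by lra.
    by apply: (off2 e eS); rewrite -E -vw.
  have [|n1 n2] := pt_on_neq_vertex (D := D) (t := w) fD eD; first by rewrite w0.
  by case: ve => E; rewrite -vw E in n1 n2.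
case: e eS eD on1 on2 avoid => P Q eS eD on1 on2 avoid.
rewrite isect_ray//; [exact: off1 | exact: off2 | |].
- by apply: avoid; left.
- by apply: avoid; right.
Qed.

Lemma crossing_sum0 S f : crossing_sum S f 0 = 0.
Proof.
rewrite /crossing_sum big1// => e _; case: ifP => // h.
by apply/eqP/negPn/negP => /cparam_itv/andP[h' _]; have := lt_trans h h'; rewrite ltxx.
Qed.

Lemma strand_alpha_sum D A s B f t : strand_virtual alpha A s B D ->
  {subset chain A s B <= edges D} -> f \in edges D ->
  alpha_sum alpha (deco D) (chain A s B) f t = crossing_sum (chain A s B) f t.
Proof.
move=> sv sub fD; rewrite /alpha_sum /crossing_sum big_mkcond /=.
apply: eq_big_seq => e eS; have [->|n0] := eqVneq (isect f e) 0; first by rewrite !if_same.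
have n1 : isect e f != 0 by rewrite isect_neqC.
rewrite (deco_flip_isect (sub e eS) fD n1) is_alpha_flip.
by rewrite sv//; [rewrite /is_alpha asboolT | exact: isect_crosses].
Qed.

Lemma crossing_off_strand D A s B F f g : perm_eq (edges D) (chain A s B ++ F) ->
  f \in F -> g \in F -> isect f g != 0 ->
  off_strand (chain A s B) (pt_on f (cparam f g)).
Proof.
move=> p fF gF n0 e eS on.
have mF h : h \in F -> h \in edges D by move=> hF; rewrite (perm_mem p) mem_cat hF orbT.
have eD : e \in edges D by rewrite (perm_mem p) mem_cat eS.
have ne h : h \in F -> h <> e.
  move=> hF E; have := redraw_source_notin (edges_closed D) p (chain_source eS).
  by rewrite -E map_f.
have onf : on_seg (pt_on f (cparam f g)) f by exists (cparam f g) => //; exact: cparam_itvW.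
have ong : on_seg (pt_on f (cparam f g)) g.
  rewrite (pt_on_cparam n0); exists (cparam g f) => //.
  by apply: cparam_itvW; rewrite isect_neqC.
have [_ _ _ h] := edges_generic D.
case: (h f g e _ (mF f fF) (mF g gF) eD onf ong on) => E.
- by rewrite E isectxx in n0.
- exact: (ne g gF).
- exact: (ne f fF).
Qed.

Lemma vertex_off_strand D A s B F v : perm_eq (edges D) (chain A s B ++ F) ->
  v \in unzip1 F -> v \in unzip2 F -> off_strand (chain A s B) v.
Proof.
move=> p v1 v2 e eS on; have cl := edges_closed D.
have eD : e \in edges D by rewrite (perm_mem p) mem_cat eS.
case/mapP: v1 => f fF E; have fD : f \in edges D by rewrite (perm_mem p) mem_cat fF orbT.
have BF : B \notin unzip2 F.
  have := redraw_uniq cl p; rewrite /= mem_cat negb_or cat_uniq.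
  move=> /andP[/andP[_ A1] /and3P[_ _ u]].
  have : uniq (A :: unzip1 F) by rewrite /= A1.
  by rewrite (perm_uniq (redraw_perm cl p)) => /andP[].
rewrite E in on v2 *; case: (on_seg_source (edges_generic D) eD fD on) => h.
  have := redraw_source_notin cl p (chain_source eS).
  by rewrite -h map_f.
have := chain_target eS; rewrite -h inE => /predU1P[E'|].
  by rewrite -E' v2 in BF.
by move=> /(redraw_inner cl p)[_ _]; rewrite map_f.
Qed.

Section Shift.
Variables (A B : pt R) (s s' : seq (pt R)) (F : seq (edge R)) (D D' : diagram R T).
Hypothesis rd : redraw A s s' B F D D'.

(** Clockwise winding number about [v] of the closed curve made of the new strand followed by the
    reversed old one. *)
Definition winding v : int := ray_sum (chain A s' B) v - ray_sum (chain A s B) v.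

Definition crossing_change f t : int :=
  crossing_sum (chain A s' B) f t - crossing_sum (chain A s B) f t.

Definition off_strands v : Prop :=
  off_strand (chain A s B) v /\ off_strand (chain A s' B) v.

(** In the difference of [chain_ray] for the two strands, the correction terms at the common ends
    [A] and [B] cancel. *)
Lemma winding_shift f t1 t2 : f \in F -> 0 <= t1 <= 1 -> 0 <= t2 <= 1 ->
  off_strands (pt_on f t1) -> off_strands (pt_on f t2) ->
  winding (pt_on f t2) - crossing_change f t2 = winding (pt_on f t1) - crossing_change f t1.
Proof.
move=> fF; wlog: t1 t2 / t1 < t2.
  by move=> h h1 h2 o1 o2; case: (ltgtP t1 t2) => [lt|lt|->//]; [|symmetry]; exact: h.
move=> t12 /andP[t10 _] /andP[_ t21] [o1 o1'] [o2 o2'].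
have [sub sF sub' sF'] := redraw_sub rd.
have E := chain_ray sub (sF _ fF) t10 t12 t21 o1 o2.
have E' := chain_ray sub' (sF' _ fF) t10 t12 t21 o1' o2'.
by rewrite /winding /crossing_change; lia.
Qed.

(** Here [kappa f] is the winding number at the start of [f], extrapolated from other points of [f]
    when that start lies on a strand, and [delta v] is the amount added to the label of [v]. At a
    vertex between two edges of [F], which is off both strands, the two edges give the same value,
    namely the winding number there. *)
Lemma exists_shift : exists (kappa : edge R -> int) (delta : pt R -> int),
  [/\ forall f t, f \in F -> 0 <= t <= 1 -> off_strands (pt_on f t) ->
        winding (pt_on f t) = kappa f + crossing_change f t,
      forall f, f \in F -> delta f.1 = kappa f &
      forall f, f \in F -> delta f.2 = kappa f + crossing_change f 1].
Proof.
have [p1 p2 _] := rd; have cl := edges_closed D.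
have /choice[kappa hk] : forall f, exists k : int, f \in F -> forall t, 0 <= t <= 1 ->
    off_strands (pt_on f t) -> winding (pt_on f t) = k + crossing_change f t.
  move=> f; have [[t [t01 ot]]|none] := pselect (exists t, 0 <= t <= 1 /\ off_strands (pt_on f t)).
    exists (winding (pt_on f t) - crossing_change f t) => fF t' t01' ot'.
    by rewrite -(winding_shift fF t01 t01' ot ot') subrK.
  by exists 0 => _ t t01 ot; case: none; exists t.
(* No edge of [F] leaves [A], so there the shift is read off from the incoming edge; elsewhere it is
   read off from the outgoing one. *)
have /choice[delta hd] : forall v, exists d : int,
    (v = A -> forall f, f \in F -> f.2 = v -> d = kappa f + crossing_change f 1) /\
    (v <> A -> forall f, f \in F -> f.1 = v -> d = kappa f).
  move=> v; have [->|vA] := eqVneq v A.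
    have [[f [fF fA]]|none] := pselect (exists f, f \in F /\ f.2 = A).
      exists (kappa f + crossing_change f 1); split=> // _ g gF gA.
      by rewrite (target_inj cl (redraw_memF rd fF) (redraw_memF rd gF)) ?fA.
    by exists 0; split=> // _ f fF fA; case: none; exists f.
  have [[f [fF fv]]|none] := pselect (exists f, f \in F /\ f.1 = v).
    exists (kappa f); split=> [E|_ g gF gv]; first by rewrite E eqxx in vA.
    by rewrite (source_inj cl (redraw_memF rd fF) (redraw_memF rd gF)) ?fv.
  by exists 0; split=> [E|_ f fF fv]; [rewrite E eqxx in vA | case: none; exists f].
have A1 : A \notin unzip1 F by apply: (redraw_source_notin cl p1); rewrite inE eqxx.
have d1 f : f \in F -> delta f.1 = kappa f.
  move=> fF; have [_ h] := hd f.1; apply: h => // E.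
  by rewrite -E map_f in A1.
exists kappa, delta; split=> // [f t fF|f fF]; first exact: hk.
have [E|E] := pselect (f.2 = A); first by have [h _] := hd f.2; exact: h.
have f2 : f.2 \in unzip2 F by exact: map_f.
have f1 : f.2 \in unzip1 F.
  have : f.2 \in A :: unzip1 F by rewrite (perm_mem (redraw_perm cl p1)) inE f2 orbT.
  by rewrite inE => /predU1P[].
have off : off_strands f.2 by split; [exact: vertex_off_strand p1 _ _ | exact: vertex_off_strand p2 _ _].
case/mapP: f1 => g gF gE; rewrite {1}gE d1//.
have := hk g gF 0 _; rewrite pt_on0 -gE lexx ler01 => /(_ isT off).
rewrite /crossing_change !crossing_sum0 subrr addr0 => <-.
by have := hk f fF 1 _; rewrite pt_on1 lexx ler01 => /(_ isT off).
Qed.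

End Shift.

(** With labels shifted by [delta], the height at any point of [F] off the strands grows by the
    winding number about that point. The two strands of a crossing share the point, so their
    difference is kept; crossings on the moved strand are virtual and weigh nothing. *)
Lemma detour_alpha_transfers A s s' B F D D' :
  redraw A s s' B F D D' -> strand_virtual alpha A s B D -> strand_virtual alpha A s' B D' ->
  transfers alpha D D'.
Proof.
move=> rd sv sv' k H k0 lH; have [p1 p2 _] := rd.
have [kappa [delta [hk d1 d2]]] := exists_shift rd.
have [sS sF sS' sF'] := redraw_sub rd.
have change f t : f \in F -> asum D' f t = asum D f t + crossing_change A B s s' f t.
  move=> fF; rewrite (redraw_asum _ _ _ rd) (redraw_asum _ _ _ (redraw_sym rd)).
  rewrite (redraw_asumF _ _ rd fF) !strand_alpha_sum ?sF ?sF'//.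
  by rewrite /crossing_change; lia.
have [|H' [h1 h2]] := labelling_extend (alpha := alpha) (H := fun v => H v + delta v) p2.
  by move=> f fF; rewrite change// (lH f (sF f fF)) d1// d2//; lia.
exists H' => //.
rewrite (index_count_split _ _ _ p1) (index_count_split _ _ _ p2).
rewrite (strand_cross_weight _ _ _ sv sS) (strand_cross_weight _ _ _ sv sF).
rewrite (strand_cross_weight _ _ _ sv' sS') (strand_cross_weight _ _ _ sv' sF').
congr (_ + _).
apply: eq_big_seq => e eF; apply: eq_big_seq => f fF.
apply: (redraw_cross_weight _ rd) => // n0.
have n1 : isect f e != 0 by rewrite isect_neqC.
have [_ _ e1 _] := redraw_endsF rd eF; have [_ _ f1 _] := redraw_endsF rd fF.
have off g h : g \in F -> h \in F -> isect g h != 0 ->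
    off_strands A B s s' (pt_on g (cparam g h)).
  by move=> gF hF n; split; [exact: crossing_off_strand p1 gF hF n | exact: crossing_off_strand p2 gF hF n].
have we := hk e _ eF (cparam_itvW n0) (off e f eF fF n0).
have wf := hk f _ fF (cparam_itvW n1) (off f e fF eF n1).
rewrite (pt_on_cparam n0) wf in we.
by rewrite /height !change// !h1// !d1//; lia.
Qed.

Lemma detour_transfers D D' : detour D D' -> transfers alpha D D' /\ transfers alpha D' D.
Proof.
case=> c [A [s [s' [B [F [rd sv sv']]]]]].
have rd' := redraw_sym rd; have [E|ca] := pselect (c = alpha).
  by rewrite E in sv sv'; split; [exact: detour_alpha_transfers rd _ _ | exact: detour_alpha_transfers rd' _ _].
by split; [exact: detour_other_transfers ca rd _ _ | exact: detour_other_transfers ca rd' _ _].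
Qed.

End AlphaDetour.

(** * Planar isotopy *)

Section Isotopy.
Variables (R : realType) (T : Type) (alpha : T).
Implicit Types (A B C v : pt R) (e f g : edge R) (t : R).
Implicit Types (D : diagram R T) (H : pt R -> int).

Local Notation asum D := (alpha_sum alpha (deco D) (edges D)).
Local Notation count := (index_count alpha).
Local Notation cw := (cross_weight alpha).

Lemma index_count_ext k D H1 H2 : (forall e, e \in edges D -> H1 e.1 = H2 e.1) ->
  count k D H1 = count k D H2.
Proof.
move=> h; apply: eq_big_seq => e eD; apply: eq_big_seq => f fD.
by rewrite /cross_weight /height !h.
Qed.

Lemma labelling_ext D H1 H2 : (forall e, e \in edges D -> H1 e.1 = H2 e.1) ->
  labelling alpha D H1 -> labelling alpha D H2.
Proof.
move=> h lH e eD; rewrite -h// -lH//.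
by have [f fD <-] := target_source (edges_closed D) eD; rewrite h.
Qed.

Section CombinatorialIsotopy.
Variables (D D' : diagram R T) (hv : pt R -> pt R).
Local Notation m := (move_edge hv).
Hypotheses (mE : perm_eq (edges D') (map m (edges D)))
  (mI : forall e f, e \in edges D -> f \in edges D -> isect (m e) (m f) = isect e f)
  (mP : forall e f g, e \in edges D -> f \in edges D -> g \in edges D ->
    isect e f != 0 -> isect e g != 0 ->
    (cparam (m e) (m f) < cparam (m e) (m g)) = (cparam e f < cparam e g))
  (mD : forall e f, e \in edges D -> f \in edges D -> isect e f != 0 ->
    deco D' (m e) (m f) = deco D e f).

Let asum_map e t t' : e \in edges D ->
  (forall f, f \in edges D -> isect e f != 0 ->
     (cparam (m e) (m f) < t') = (cparam e f < t)) ->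
  asum D' (m e) t' = asum D e t.
Proof.
move=> eD ht; rewrite (perm_alpha_sum _ _ _ _ mE) /alpha_sum big_map.
rewrite big_mkcond [RHS]big_mkcond /=; apply: eq_big_seq => f fD; rewrite mI//.
have [->|n0] := eqVneq (isect e f) 0; first by rewrite !if_same.
by rewrite mD// ht.
Qed.

Let asum1 e : e \in edges D -> asum D' (m e) 1 = asum D e 1.
Proof.
move=> eD; apply: asum_map => // f fD n0.
have /andP[_ ->] := cparam_itv n0.
by have /andP[_ ->] : 0 < cparam (m e) (m f) < 1 by apply: cparam_itv; rewrite mI.
Qed.

Lemma isotopy_labelling H' :
  labelling alpha D (H' \o hv) <-> labelling alpha D' H'.
Proof.
split=> lH e.
  rewrite (perm_mem mE) => /mapP[f fD ->].
  by rewrite asum1//; exact: lH.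
move=> eD; rewrite -asum1//; apply: (lH (m e)).
by rewrite (perm_mem mE) map_f.
Qed.

Lemma isotopy_count k H' : count k D' H' = count k D (H' \o hv).
Proof.
rewrite /index_count (perm_big _ mE) big_map /=; apply: eq_big_seq => e eD.
rewrite (perm_big _ mE) big_map /=; apply: eq_big_seq => f fD.
rewrite /cross_weight mI//; have [->|n0] := eqVneq (isect e f) 0.
  by rewrite !weight0.
have n1 : isect f e != 0 by rewrite isect_neqC.
rewrite mD// /height (asum_map (t := cparam e f))//; last first.
  by move=> g gD n; rewrite mP.
by rewrite (asum_map (t := cparam f e))// => g gD n; rewrite mP.
Qed.

(** Labellings correspond under composition with the vertex map, which is injective on the vertices
    since the sources of [D'] are distinct; away from their images the new label is set to 0. *)
Lemma isotopy_transfers : transfers alpha D D' /\ transfers alpha D' D.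
Proof.
have [u _] := edges_closed D'.
have inj e f : e \in edges D -> f \in edges D -> hv e.1 = hv f.1 -> e = f.
  rewrite (perm_uniq (perm_map _ mE)) -map_comp in u.
  by move=> eD fD; exact: map_uniq_inj u eD fD.
split=> k H k0 lH; last first.
  by exists (H \o hv); [exact/isotopy_labelling | rewrite -isotopy_count].
have /choice[H' hH'] : forall w, exists i : int,
    forall e, e \in edges D -> hv e.1 = w -> i = H e.1.
  move=> w; have [[e [eD ew]]|none] := pselect (exists e, e \in edges D /\ hv e.1 = w).
    by exists (H e.1) => f fD fw; rewrite (inj e f)// ew.
  by exists 0 => e eD ew; case: none; exists e.
have HH e : e \in edges D -> H e.1 = (H' \o hv) e.1.
  by move=> eD; rewrite /= (hH' _ e eD erefl).
exists H'; first by apply/isotopy_labelling; exact: labelling_ext lH.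
by rewrite isotopy_count; apply: index_count_ext => e eD; rewrite -HH.
Qed.

End CombinatorialIsotopy.

Lemma nonvanishing_sign (phi : R -> R) : {within `[0, 1], continuous phi} ->
  (forall t, 0 <= t <= 1 -> phi t != 0) -> (0 < phi 0) = (0 < phi 1).
Proof.
move=> c n0.
have n t : t \in `[0, 1]%R -> phi t != 0 by rewrite in_itv => /n0.
have ivt := IVT (ler01 : 0 <= 1 :> R) c (v := 0).
apply/idP/idP => h; rewrite ltNge; apply/negP => h'.
  have [|t /n /eqP] := ivt; last by [].
  by rewrite ge_min h' orbT le_max (ltW h).
have [|t /n /eqP] := ivt; last by [].
by rewrite ge_min h' le_max (ltW h) orbT.
Qed.

Section Within.
Variable S : set R.
Implicit Types phi psi : R -> R.

Lemma within_sub phi psi : {within S, continuous phi} -> {within S, continuous psi} ->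
  {within S, continuous (fun t => phi t - psi t)}.
Proof. exact: within_continuousB. Qed.

Lemma within_mul phi psi : {within S, continuous phi} -> {within S, continuous psi} ->
  {within S, continuous (fun t => phi t * psi t)}.
Proof. by move=> c1 c2 t; exact: (@continuousM _ (subspace S) phi psi t (c1 t) (c2 t)). Qed.

Lemma within_div phi psi : {within S, continuous phi} -> {within S, continuous psi} ->
  (forall t, S t -> psi t != 0) -> {within S, continuous (fun t => phi t / psi t)}.
Proof.
move=> c1 c2 n0; rewrite continuous_subspace_in => t; rewrite inE => St.
apply: (@continuousM _ (subspace S) phi (fun u => (psi u)^-1) t (c1 t)).
exact: (@continuousV _ (subspace S) psi t (n0 t St) (c2 t)).
Qed.

Lemma within_orient (a b c : R -> pt R) :
  {within S, continuous a} -> {within S, continuous b} -> {within S, continuous c} ->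
  {within S, continuous (fun t => orient (a t) (b t) (c t))}.
Proof.
move=> ca cb cc.
have w1 (x : R -> pt R) : {within S, continuous x} -> {within S, continuous (fun t => (x t).1)}.
  by move=> cx; apply: (@within_continuous_comp _ _ _ S x fst) cx => y _; exact: cvg_fst.
have w2 (x : R -> pt R) : {within S, continuous x} -> {within S, continuous (fun t => (x t).2)}.
  by move=> cx; apply: (@within_continuous_comp _ _ _ S x snd) cx => y _; exact: cvg_snd.
by apply: within_sub; apply: within_mul; apply: within_sub; (exact: w1 || exact: w2).
Qed.

End Within.

(** Throughout the motion the orientations that decide the sign of a crossing do not vanish, and two
    crossings on an edge do not meet, for lack of triple points. By the intermediate value theorem
    signs and order are the same at both ends of the motion. *)
Lemma vertex_isotopy_transfers D D' : vertex_isotopy D D' ->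
  transfers alpha D D' /\ transfers alpha D' D.
Proof.
case=> h [hc ht p dd].
have [_ pD] := edges_closed D.
have src e : e \in edges D -> e.1 \in unzip1 (edges D) by exact: map_f.
have tgt e : e \in edges D -> e.2 \in unzip1 (edges D).
  by move=> eD; rewrite (perm_mem pD) map_f.
pose m t e := move_edge (h t) e.
have m0 e : e \in edges D -> m 0 e = e.
  move=> eD; rewrite /m /move_edge; have [-> _] := hc _ (src e eD).
  by have [-> _] := hc _ (tgt e eD); rewrite -surjective_pairing.
have t11 : 0 <= (1 : R) <= 1 by lra.
have mIs t e f : 0 <= t <= 1 -> e \in edges D -> f \in edges D ->
    (isect (m t e) (m t f) != 0) = (isect e f != 0).
  move=> t01 eD fD; have [cl gen cr] := ht t t01; apply/idP/idP => n.
    apply: (crosses_isect (edges_closed D) (edges_generic D)) => //.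
    by apply/(cr e f eD fD); exact: isect_crosses.
  apply: (crosses_isect cl gen); try exact: map_f.
  by apply/(cr e f eD fD); exact: isect_crosses.
have oc e f : e \in edges D -> f \in edges D ->
    {within `[0, 1], continuous (fun t => orient (m t f).1 (m t f).2 (m t e).1)} /\
    {within `[0, 1], continuous (fun t => orient (m t f).1 (m t f).2 (m t e).2)}.
  move=> eD fD; have [_ c1] := hc _ (src f fD); have [_ c2] := hc _ (tgt f fD).
  have [_ c3] := hc _ (src e eD); have [_ c4] := hc _ (tgt e eD).
  by split; [exact: (within_orient c1 c2 c3) | exact: (within_orient c1 c2 c4)].
have onz e f : isect e f != 0 -> orient f.1 f.2 e.1 != 0.
  by move=> /isect_neq_sides[] [h1 h2]; rewrite neq_lt ?h1 ?h2 ?orbT.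
have mI e f : e \in edges D -> f \in edges D -> isect (m 1 e) (m 1 f) = isect e f.
  move=> eD fD; have [z|n0] := eqVneq (isect e f) 0.
    by apply/eqP; have := mIs 1 e f t11 eD fD; rewrite z eqxx => /negbFE.
  rewrite (isect_sign n0) isect_sign ?mIs//.
  have [c1 _] := oc e f eD fD.
  rewrite -(nonvanishing_sign c1) ?m0// => t t01.
  by apply: onz; rewrite mIs.
apply: (isotopy_transfers (hv := h 1)) => //.
- move=> e f g eD fD gD nf ng.
  have [->|/eqP fg] := eqVneq f g; first by rewrite !ltxx.
  pose phi t := cparam (m t e) (m t g) - cparam (m t e) (m t f).
  have cpc f' : f' \in edges D -> isect e f' != 0 ->
      {within `[0, 1], continuous (fun t => cparam (m t e) (m t f'))}.
    move=> fD' n; have [c1 c2] := oc e f' eD fD'.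
    apply: (within_div c1 (within_sub c1 c2)) => t; rewrite /= in_itv /= => t01.
    have n' : isect (m t e) (m t f') != 0 by rewrite mIs.
    exact: isect_orient_neq n'.
  have : (0 < phi 0) = (0 < phi 1).
    apply: nonvanishing_sign => [t|t t01].
      by apply: within_sub t; exact: cpc.
    rewrite /phi subr_eq0; apply/eqP => E.
    have [cl gen _] := ht t t01.
    have [_ _ _ triple] := gen.
    have ne f' : f' \in edges D -> isect e f' != 0 -> isect (m t e) (m t f') != 0.
      by move=> fD' n; rewrite mIs.
    have nf' := ne f fD nf; have ng' := ne g gD ng.
    pose x := pt_on (m t e) (cparam (m t e) (m t f)).
    have on : on_seg x (m t e) by exists (cparam (m t e) (m t f)) => //; exact: cparam_itvW.
    have onf : on_seg x (m t f).
      rewrite /x pt_on_cparam//; exists (cparam (m t f) (m t e)) => //.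
      by apply: cparam_itvW; rewrite isect_neqC.
    have ong : on_seg x (m t g).
      rewrite /x -E pt_on_cparam//; exists (cparam (m t g) (m t e)) => //.
      by apply: cparam_itvW; rewrite isect_neqC.
    case: (triple (m t e) (m t f) (m t g) x) => //; try exact: map_f; move=> E'.
    + by rewrite E' isectxx in nf'.
    + apply: fg; have [u _] := cl; rewrite /unzip1 -map_comp in u.
      by apply: (map_uniq_inj u fD gD); exact: (congr1 fst E').
    + by rewrite E' isectxx in ng'.
  by rewrite /phi !subr_gt0 !m0.
- move=> e f eD fD n; apply: dd => //; exact: isect_crosses.
Qed.

End Isotopy.

(** * The knots K(n) *)

Section Invariance.
Variables (R : realType) (T : Type) (alpha : T).
Implicit Types (D : diagram R T).

Lemma elementary_move_transfers D D' : elementary_move D D' ->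
  transfers alpha D D' /\ transfers alpha D' D.
Proof.
case=> [|[|[|[|[|]]]]].
- exact: vertex_isotopy_transfers.
- exact: subdivision_transfers.
- exact: reidemeister1_transfers.
- exact: reidemeister2_transfers.
- exact: reidemeister3_transfers.
- exact: detour_transfers.
Qed.

Lemma transfers_trans D1 D2 D3 : transfers alpha D1 D2 -> transfers alpha D2 D3 ->
  transfers alpha D1 D3.
Proof.
move=> t12 t23 k H k0 /(t12 k H k0)[H2 /(t23 k H2 k0)[H3 l3 E3] E2].
by exists H3 => //; rewrite E3.
Qed.

Lemma equivalent_transfers D D' : equivalent D D' -> transfers alpha D D'.
Proof.
(* Both directions are carried along, as the induction passes through the symmetric closure. *)
suff : equivalent D D' -> transfers alpha D D' /\ transfers alpha D' D by move=> h /h[].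
elim=> [D1 D2 /elementary_move_transfers//|D1|D1 D2 _ [h1 h2]//|D1 D2 D3 _ [h1 h2] _ [h3 h4]].
- by split=> k H k0 lH; exists H.
- by split; [exact: transfers_trans h1 h3 | exact: transfers_trans h4 h2].
Qed.

End Invariance.

(** * The index of the classical crossing of K(n) *)

Section IndexOfK.
Variables (R : realType) (T : Type) (alpha beta : T).
Hypothesis alpha_neq_beta : alpha <> beta.
Variable n : nat.
Local Notation E := (K_edges R n).
Local Notation D := (K R alpha beta n).
Implicit Types (e f : edge R) (i : nat).

Definition bot_edge i : edge R := ((0, i%:R), (1, i.+1%:R)).
Definition top_edge i : edge R := ((1, i%:R), (0, i.+1%:R)).

Lemma bot_edgeK i : (i <= n.*2)%N -> bot_edge i \in E.
Proof.
move=> h; rewrite /K_edges mem_cat; apply/orP; left; apply/mapP.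
by exists i; rewrite // mem_iota.
Qed.

Lemma top_edgeK i : (i <= n.*2)%N -> top_edge i \in E.
Proof.
move=> h; rewrite /K_edges !mem_cat; apply/orP; right; apply/orP; left; apply/mapP.
by exists i; rewrite // mem_iota.
Qed.

Lemma K_edges_uniq : uniq E.
Proof. by have [/map_uniq] := K_edges_closed R n. Qed.

Lemma isect_bot_top i : isect (bot_edge i) (top_edge i) = 1.
Proof. by apply: isect_eq1; rewrite /orient /= -natr1; lra. Qed.

Lemma isect_top_bot i : isect (top_edge i) (bot_edge i) = -1.
Proof. by rewrite isectC isect_bot_top. Qed.

Lemma K_isect e f : e \in E -> f \in E -> isect e f != 0 -> exists i,
  (e = bot_edge i /\ f = top_edge i) \/ (e = top_edge i /\ f = bot_edge i).
Proof.
move=> eE fE n0; have cr := isect_crosses n0.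
case: (cr) => ef [x [[t t01 xt] [u u01 xu]]].
have gen := K_edges_generic R n.
have [e1 e2] := pt_on_neq_ends gen eE t01.
have xe : on_seg x e by exists t => //; lra.
have xf : on_seg x f by exists u => //; lra.
rewrite -xt in e1 e2.
case: (K_edges_meet eE fE xe xf) => [//|[]//|[]//|[i [h _]]].
by exists i.
Qed.

(** Indicator of the bands whose crossing has type [alpha]. *)
Definition eps i : int := ((i < n.*2)%N && ~~ odd i)%:Z.

Lemma deco_bot i f : deco D (bot_edge i) f =
  if (i < n.*2)%N then Virtual (if odd i then beta else alpha) else Over.
Proof. by rewrite /= /K_deco /= natrK eqxx. Qed.

Lemma deco_top i f : deco D (top_edge i) f =
  if (i < n.*2)%N then Virtual (if odd i then beta else alpha) else Under.
Proof. by rewrite /= /K_deco /= natrK oner_eq0. Qed.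

Lemma is_alpha_bot i f : is_alpha alpha (deco D (bot_edge i) f) = (i < n.*2)%N && ~~ odd i.
Proof.
rewrite deco_bot; case: ifP => _ /=; last by apply/asboolP.
case: odd => /=; last by apply/asboolP.
by apply/asboolP => -[E]; exact: alpha_neq_beta.
Qed.

Lemma is_alpha_top i f : is_alpha alpha (deco D (top_edge i) f) = (i < n.*2)%N && ~~ odd i.
Proof.
rewrite deco_top; case: ifP => _ /=; last by apply/asboolP.
case: odd => /=; last by apply/asboolP.
by apply/asboolP => -[E]; exact: alpha_neq_beta.
Qed.

Lemma big_seq_only (I : eqType) (r : seq I) (F : I -> int) x : uniq r -> x \in r ->
  (forall y, y \in r -> y != x -> F y = 0) -> \sum_(y <- r) F y = F x.
Proof.
move=> u xr h; rewrite (bigD1_seq x)//= big_seq_cond big1 ?addr0// => y /andP[yr yx].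
exact: h.
Qed.

Lemma big_seq_two (I : eqType) (r : seq I) (F : I -> int) x y : uniq r ->
  x \in r -> y \in r -> y != x ->
  (forall z, z \in r -> z != x -> z != y -> F z = 0) -> \sum_(z <- r) F z = F x + F y.
Proof.
move=> u xr yr yx h; rewrite (bigD1_seq x)//= -big_filter.
rewrite (@big_seq_only _ _ _ y) ?filter_uniq ?mem_filter ?yx//.
by move=> z; rewrite mem_filter => /andP[zx zr] zy; exact: h.
Qed.

Lemma bot_edge_inj i j : bot_edge i = bot_edge j -> i = j.
Proof. by case=> /eqP; rewrite eqr_nat => /eqP. Qed.

Lemma top_edge_inj i j : top_edge i = top_edge j -> i = j.
Proof. by case=> /eqP; rewrite eqr_nat => /eqP. Qed.

Lemma bot_neq_top i j : bot_edge i <> top_edge j.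
Proof. by case=> h _ _ _; move: (oner_neq0 R); rewrite -h eqxx. Qed.

Lemma bot_edge_le i : bot_edge i \in E -> (i <= n.*2)%N.
Proof.
rewrite /K_edges !mem_cat => /or4P[/mapP[j]|/mapP[j]||].
- by rewrite mem_iota => /andP[_ h] /bot_edge_inj ->.
- by move=> _ /bot_neq_top.
- by rewrite !inE => /orP[] /eqP [] *; exfalso; lra.
- by rewrite !inE => /or3P[] /eqP [] *; exfalso; lra.
Qed.

Lemma top_edge_le i : top_edge i \in E -> (i <= n.*2)%N.
Proof.
rewrite /K_edges !mem_cat => /or4P[/mapP[j]|/mapP[j]||].
- by move=> _ /esym/bot_neq_top.
- by rewrite mem_iota => /andP[_ h] /top_edge_inj ->.
- by rewrite !inE => /orP[] /eqP [] *; exfalso; lra.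
- by rewrite !inE => /or3P[] /eqP [] *; exfalso; lra.
Qed.

Lemma isect_bot i f : (i <= n.*2)%N -> f \in E -> f != top_edge i ->
  isect (bot_edge i) f = 0.
Proof.
move=> iN fE ne; apply/eqP/negPn/negP => /(K_isect (bot_edgeK iN) fE)[j []] [h1 h2].
  by move: ne; rewrite h2 (bot_edge_inj h1) eqxx.
by case: (bot_neq_top h1).
Qed.

Lemma isect_top i f : (i <= n.*2)%N -> f \in E -> f != bot_edge i ->
  isect (top_edge i) f = 0.
Proof.
move=> iN fE ne; apply/eqP/negPn/negP => /(K_isect (top_edgeK iN) fE)[j []] [h1 h2].
  by case: (bot_neq_top (esym h1)).
by move: ne; rewrite h2 (top_edge_inj h1) eqxx.
Qed.

Lemma alpha_sum_bot i t : (i <= n.*2)%N -> cparam (bot_edge i) (top_edge i) < t ->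
  alpha_sum alpha (deco D) E (bot_edge i) t = eps i.
Proof.
move=> iN lt; rewrite /alpha_sum big_mkcond /= (big_seq_only K_edges_uniq (top_edgeK iN)).
  by rewrite is_alpha_bot lt andbT isect_bot_top /eps; case: ifP.
by move=> f fE ne; rewrite isect_bot// if_same.
Qed.

Lemma alpha_sum_top i t : (i <= n.*2)%N -> cparam (top_edge i) (bot_edge i) < t ->
  alpha_sum alpha (deco D) E (top_edge i) t = - eps i.
Proof.
move=> iN lt; rewrite /alpha_sum big_mkcond /= (big_seq_only K_edges_uniq (bot_edgeK iN)).
  by rewrite is_alpha_top lt andbT isect_top_bot /eps; case: ifP.
by move=> f fE ne; rewrite isect_top// if_same.
Qed.

Lemma alpha_sum_last_bot t : alpha_sum alpha (deco D) E (bot_edge n.*2) t = 0.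
Proof. by apply: alpha_sum_eq0 => f _ _; rewrite is_alpha_bot ltnn. Qed.

Lemma alpha_sum_last_top t : alpha_sum alpha (deco D) E (top_edge n.*2) t = 0.
Proof. by apply: alpha_sum_eq0 => f _ _; rewrite is_alpha_top ltnn. Qed.

Lemma cparam_lt1 e f : isect e f != 0 -> cparam e f < 1.
Proof. by case/cparam_itv/andP. Qed.

Lemma alpha_sum_arc e t : e \in E -> e.1.1 <> 0 \/ e.2.1 <> 1 ->
  e.1.1 <> 1 \/ e.2.1 <> 0 -> alpha_sum alpha (deco D) E e t = 0.
Proof.
move=> eE h1 h2; apply: alpha_sum_eq0 => f fE /(K_isect eE fE)[i [] [E1 E2]].
  by case: h1; rewrite E1.
by case: h2; rewrite E1.
Qed.

Section Values.
Variable H : pt R -> int.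
Hypothesis lH : labelling alpha D H.

Lemma label_bot i : (i <= n.*2)%N -> H (1, i.+1%:R) = H (0, i%:R) + eps i.
Proof.
move=> iN; have := lH (bot_edgeK iN); rewrite alpha_sum_bot//.
by rewrite cparam_lt1// isect_bot_top.
Qed.

Lemma label_top i : (i <= n.*2)%N -> H (0, i.+1%:R) = H (1, i%:R) - eps i.
Proof.
move=> iN; have := lH (top_edgeK iN); rewrite alpha_sum_top//.
by rewrite cparam_lt1// isect_top_bot.
Qed.

(** Two consecutive bands bring both strands back to their sides, and the [alpha]-crossing of the
    pair has raised one label and lowered the other by 1. *)
Lemma label_double j : (j <= n)%N ->
  H (0, j.*2%:R) = H (0, 0) + j%:Z /\ H (1, j.*2%:R) = H (1, 0) - j%:Z.
Proof.
elim: j => [|j IH] jn; first by rewrite addr0 subr0.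
have [E1 E2] := IH (ltnW jn).
have h1 : (j.*2 <= n.*2)%N by rewrite leq_double ltnW.
have h2 : (j.*2.+1 <= n.*2)%N by rewrite ltn_double.
rewrite doubleS label_top// label_bot// label_bot// label_top// E1 E2.
rewrite /eps odd_double /= odd_double ltn_double jn andbF /=.
by lia.
Qed.

(** The inner arc and the classical band pass on labels unchanged, so [H (1, 0)] equals
    [H (0, n.*2%:R)]. On the right side the label then drops by [n] over the virtual bands. *)
Lemma label_index : H (0, n.*2%:R) - H (1, n.*2%:R) = n%:Z.
Proof.
have [E1 E2] := label_double (leqnn n).
have in1 : ((1, n.*2.+1%:R), (2, 0)) \in E.
  by rewrite /K_edges !mem_cat !inE eqxx !orbT.
have in2 : ((2, 0), (1, 0)) \in E by rewrite /K_edges !mem_cat !inE eqxx !orbT.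
have := lH in1; rewrite alpha_sum_arc//=; [|by left; lra|by right; lra].
have := lH in2; rewrite alpha_sum_arc//=; [|by left; lra|by left; lra].
rewrite !addr0 label_bot// /eps ltnn addr0 => a2 a1.
by rewrite E2 a2 a1 opprB addrC subrK.
Qed.

Lemma index_count_K k : index_count alpha k D H = if n%:Z == k then 2 else 0.
Proof.
have i1 := bot_edgeK (leqnn n.*2); have i2 := top_edgeK (leqnn n.*2).
have ne : top_edge n.*2 != bot_edge n.*2 by apply/eqP => /esym/bot_neq_top.
have w12 : cross_weight alpha k D H (bot_edge n.*2) (top_edge n.*2) = (n%:Z == k)%:Z.
  rewrite /cross_weight deco_bot ltnn isect_bot_top /weight /= !mul1r.
  by rewrite /height alpha_sum_last_bot alpha_sum_last_top !addr0 /= label_index.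
rewrite /index_count (big_seq_two K_edges_uniq i1 i2 ne); last first.
  move=> e eE nb nt; rewrite big1_seq// => f /andP[_ fE]; rewrite /cross_weight.
  have [->|n0] := eqVneq (isect e f) 0; first by rewrite weight0.
  have [i [] [E1 _]] := K_isect eE fE n0; rewrite E1 in eE nb nt *.
    rewrite deco_bot; case: ifP => [_|]; first by rewrite weight_virtual.
    by have := bot_edge_le eE; rewrite leq_eqVlt => /predU1P[E|->//]; rewrite E eqxx in nb.
  rewrite deco_top; case: ifP => [_|]; first by rewrite weight_virtual.
  by have := top_edge_le eE; rewrite leq_eqVlt => /predU1P[E|->//]; rewrite E eqxx in nt.
rewrite (big_seq_only K_edges_uniq i2) => [|f fE nf]; last first.
  by rewrite /cross_weight isect_bot ?weight0.
rewrite (big_seq_only K_edges_uniq i1) => [|f fE nf]; last first.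
  by rewrite /cross_weight isect_top ?weight0.
by rewrite (@cross_weightC R T alpha k D H _ _ i1 i2) w12; case: eqP.
Qed.

End Values.

(** Solution of the recursion of [label_bot] and [label_top] with value 0 at the bottom left, on the
    left side here and on the right side in [K_label_right]. The top row is set apart because the
    band below it, though of even number, has no [alpha]-crossing. *)
Definition K_label_left i : nat :=
  if i == n.*2.+1 then 0%N else if odd i then (n - i./2).-1 else i./2.

Definition K_label_right i : nat :=
  if i == n.*2.+1 then n else if odd i then i./2.+1 else (n - i./2)%N.

Definition K_label (v : pt R) : int :=
  if v.1 == 0 then K_label_left (Num.truncn v.2)
  else if v.1 == 1 then K_label_right (Num.truncn v.2)
  else if v.1 == 2 then n else 0%N.

Lemma K_label_step i : (i <= n.*2)%N ->
  (K_label_right i.+1)%:Z = (K_label_left i)%:Z + eps i /\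
  (K_label_left i.+1)%:Z = (K_label_right i)%:Z - eps i.
Proof.
rewrite /K_label_left /K_label_right /eps => iN.
rewrite eqSS (ltn_eqF (_ : (i < n.*2.+1)%N))// ltn_neqAle iN andbT.
have := odd_double_half i; case: eqP => [->|ne].
  by rewrite odd_double doubleK subnn /= => _; split; lia.
rewrite /= uphalf_half; case: odd => /= h; split; lia.
Qed.

Lemma K_labelling : labelling alpha D K_label.
Proof.
have L (i : nat) : K_label (0, i%:R) = K_label_left i by rewrite /K_label /= eqxx natrK.
have Rr (i : nat) : K_label (1, i%:R) = K_label_right i.
  by rewrite /K_label /= oner_eq0 eqxx natrK.
have n30 : (3 == 0 :> R) = false by apply/eqP; lra.
have n31 : (3 == 1 :> R) = false by apply/eqP; lra.
have n32 : (3 == 2 :> R) = false by apply/eqP; lra.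
have n20 : (2 == 0 :> R) = false by apply/eqP; lra.
have n21 : (2 == 1 :> R) = false by apply/eqP; lra.
have L3 y : K_label (3, y) = 0 by rewrite /K_label /= n30 n31 n32.
have L2 : K_label (2, 0) = n by rewrite /K_label /= n20 n21 eqxx.
have R0 : K_label (1, 0) = n by rewrite -[0]/(0%:R) Rr /K_label_right /= subn0.
have L0 : K_label (0, 0) = 0 by exact: (L 0%N).
have Rn : K_label (1, n.*2.+1%:R) = n by rewrite Rr /K_label_right eqxx.
have Ln : K_label (0, n.*2.+1%:R) = 0 by rewrite L /K_label_left eqxx.
move=> e eE; have [j Hj] := K_edgesP eE; case: Hj eE => [i iN|i iN|||||] eE /=;
  last 5 first.
- by rewrite alpha_sum_arc//=; [rewrite Rn L2 addr0|left; lra|right; lra].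
- by rewrite alpha_sum_arc//=; [rewrite R0 L2 addr0|left; lra|left; lra].
- by rewrite alpha_sum_arc//=; [rewrite Ln L3 addr0|right; lra|left; lra].
- by rewrite alpha_sum_arc//=; [rewrite !L3 addr0|left; lra|left; lra].
- by rewrite alpha_sum_arc//=; [rewrite L0 L3 addr0|left; lra|left; lra].
- have [E1 _] := K_label_step iN.
  rewrite (alpha_sum_bot iN) ?L ?Rr ?E1//.
  by rewrite cparam_lt1// isect_bot_top.
- have [_ E1] := K_label_step iN.
  rewrite (alpha_sum_top iN) ?L ?Rr ?E1//.
  by rewrite cparam_lt1// isect_top_bot.
Qed.
End IndexOfK.

Local Open Scope nat_scope.

Theorem proposition6p5 (R : realType) (T : Type) (alpha beta : T)
  (alpha_neq_beta : alpha <> beta) (p q : nat)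
  (prime_p : prime p) (odd_p : odd p) (prime_q : prime q) (odd_q : odd q)
  (p_lt_q : p < q) :
  ~ equivalent (K R alpha beta p) (K R alpha beta q).
Proof.
move=> /(equivalent_transfers (alpha := alpha)) tr.
have p0 : p%:Z != 0%R by rewrite eqz_nat -lt0n prime_gt0.
have lK := @K_labelling R T alpha beta alpha_neq_beta p.
have [H lH] := tr _ _ p0 lK.
(* For [k = p] the count is 0 on K(q), whose only index is [q > p], but 2 on K(p). *)
rewrite (index_count_K alpha_neq_beta lH) (index_count_K alpha_neq_beta lK).
by rewrite eqxx eqz_nat (gtn_eqF p_lt_q).
Qed.
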